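(* For all $\alpha\in(0,\infty)\setminus\{1\}$, there exists a $\sigma_*(\alpha)$ so that if $\sigma\ge\sigma_*(\alpha)$ ($\sigma$ an integer) then, for all $\varepsilon\in(0,1)$ and all $K$ and $n$ sufficiently large, the mixing time of $\mathrm{DAR}_n^\sigma(\alpha,K)$ satisfies $t_{\mathrm{mix}}(\varepsilon)\le 60\log n$. Furthermore, with these parameters, when $\alpha<1$, the proportion of links which are full, in equilibrium, may be made as small as desired by taking $K$ sufficiently large (independently of $n$): for every $\delta>0$ there is $K_1$, not depending on $n$, such that for all $K\ge K_1$ and all $n$ sufficiently large, $\sum_{x\in\Omega}\Pi(x)\varphi(x)\le\delta$.
   Context: Let $K,n\ge1$ and $\sigma\ge0$ be integers with $K>\sigma$, $\alpha>0$, $\Omega:=\{0,1,\dots,K\}^n$. For $x\in\Omega$ let $f=\varphi(x):=\tfrac1n|\{j: x_j=K\}|$ (proportion of full links) and $g=g(x):=\tfrac1n|\{j:x_j\ge K-\sigma\}|$. $\mathrm{DAR}_n^\sigma(\alpha,K)$ (dynamic alternative routing with trunk reservation $\sigma$) denotes the continuous-time Markov chain $X=(X^t)_{t\ge0}$ on $\Omega$ with the following transitions from state $x$: $x_j\to x_j+1$ at rate $\alpha K$ if $K-\sigma\le x_j<K$, and at rate $\alpha K(1+2f(1-g))$ if $x_j<K-\sigma$; $x_j\to x_j-1$ at rate $x_j$; no other transitions. $\Pi$ denotes its invariant distribution and $t_{\mathrm{mix}}(\varepsilon):=\inf\{t\ge0:\max_{x\in\Omega}\|\mathbb{P}_x(X^t\in\cdot)-\Pi\|_{\mathrm{TV}}\le\varepsilon\}$.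 The number $\sigma_*(\alpha)$ depends only on $\alpha$, not on $K$ or $n$. ''For all $K$ and $n$ sufficiently large'' means: there is $K_0$ such that for every $K\ge K_0$ there is $n_0$ (possibly depending on $K$) such that the assertion holds for all $n\ge n_0$; $K_0,n_0$ may depend on the parameters quantified before this phrase. *)

(* Defs.v *)
(* MathComp / MathComp-Analysis. *)
From HB Require Import structures.
From mathcomp Require Import all_boot all_order all_algebra.
From mathcomp Require Import all_classical all_reals all_analysis.
Set Implicit Arguments.
Unset Strict Implicit.
Unset Printing Implicit Defensive.
Import Order.TTheory GRing.Theory Num.Theory.
Import numFieldNormedType.Exports.
Local Open Scope classical_set_scope.
Local Open Scope ring_scope.

(* Entrywise sum of the series of A ^+ k / k!, which always converges. *)
Definition expmx (R : realType) (N : nat) (A : 'M[R]_N) : 'M[R]_N :=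
  \matrix_(i, j) limn (series (fun k : nat => (A ^+ k) i j / k`!%:R)).

(* Continuous-time Markov chains on a finite type S, given by the jump rates
   q x y for x != y; the values q x x are ignored. *)

Definition generator (R : realType) (S : finType) (q : S -> S -> R) :
    'M[R]_#|S| :=
  \matrix_(i, j)
    if i == j then - \sum_(z : S | z != enum_val i) q (enum_val i) z
    else q (enum_val i) (enum_val j).

(* P_x(X^t = y) *)
Definition transition (R : realType) (S : finType) (q : S -> S -> R)
    (t : R) (x y : S) : R :=
  expmx (t *: generator q) (enum_rank x) (enum_rank y).

Definition is_distribution (R : realType) (S : finType) (mu : S -> R) : Prop :=
  (forall x, 0 <= mu x) /\ \sum_(x : S) mu x = 1.

Definition is_invariant (R : realType) (S : finType) (q : S -> S -> R)
    (Pi : S -> R) : Prop :=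
  is_distribution Pi /\
  forall t : R, 0 <= t ->
    forall y : S, \sum_(x : S) Pi x * transition q t x y = Pi y.

(* Maximal discrepancy over events, so the values lie in [0, 1] for
   probability distributions. *)
Definition tv_dist (R : realType) (S : finType) (mu nu : S -> R) : R :=
  \big[Num.max/0]_(A : {set S})
    `| \sum_(x in A) mu x - \sum_(x in A) nu x |.

(* Extended-real infimum: equals +oo if the level eps is never reached. *)
Definition tmix (R : realType) (S : finType) (q : S -> S -> R) (Pi : S -> R)
    (eps : R) : \bar R :=
  ereal_inf [set t%:E | t in [set t : R | 0 <= t /\
    \big[Num.max/0]_(x : S) tv_dist (transition q t x) Pi <= eps]].

Definition state (K n : nat) : finType := {ffun 'I_n -> 'I_K.+1}.

Definition full_prop (R : realType) (K n : nat) (x : state K n) : R :=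
  #|[pred j : 'I_n | x j == K :> nat]|%:R / n%:R.

Definition reserved_prop (R : realType) (sigma K n : nat) (x : state K n) : R :=
  #|[pred j : 'I_n | (K - sigma <= x j)%N]|%:R / n%:R.

Definition up_rate (R : realType) (alpha : R) (sigma K n : nat)
    (x : state K n) (j : 'I_n) : R :=
  if (x j < K - sigma)%N then
    alpha * K%:R * (1 + 2 * full_prop R x * (1 - reserved_prop R sigma x))
  else if (x j < K)%N then alpha * K%:R
  else 0.

(* For x != y at most one coordinate j contributes to the sum. *)
Definition dar_rate (R : realType) (alpha : R) (sigma K n : nat)
    (x y : state K n) : R :=
  \sum_(j < n | [forall i : 'I_n, (i != j) ==> (y i == x i)])
    if y j == (x j).+1 :> nat then up_rate alpha sigma x j
    else if (y j).+1 == x j :> nat then (x j)%:R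
    else 0.
Arguments dar_rate {R} alpha sigma K n x y.

(* Main.v *)
Require Import Defs.
From HB Require Import structures.
From mathcomp Require Import all_boot all_order all_algebra.
From mathcomp Require Import all_classical all_reals all_analysis.
From mathcomp Require Import ring lra zify.
Import Order.TTheory GRing.Theory Num.Theory.
Import numFieldNormedType.Exports.
Local Open Scope classical_set_scope.
Local Open Scope ring_scope.

(** Proof.  Couple two copies of the network coordinatewise: in each link the
    common part of the rates moves both copies, the excess moves only one.  Measure
    the discrepancy by [d = \sum_i `|w (x_i) - w (y_i)|].  A link that is reserved
    in exactly one copy misses the extra rate [a] there, and this pays exactly for
    the change of [a] caused by the change of [g]; a link that is full in exactly
    one copy is attracted at rate [alpha K] weighted by the slope [h] of [w] at
    [K - 1], which pays for the change of [f] as soon as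
    [2 (1 - g)^2 h(K - sigma - 1) <= h(K - 1)].  For [alpha > 1] take [w] linear, as
    [1 - g] is small; for [alpha < 1] take [w] convex with a geometric part of
    ratio [2 / (1 + alpha)], which is admissible once [f] is small.  Hence [d]
    contracts at rate 1/2 outside a set of bad states.

    The bad set is controlled by a geometric one-link Lyapunov function [v] with
    drift at most [k1 (c1 - v)] whatever the extra rate is: the exponential moment
    of [\sum_i v (x_i)] shows that after a time independent of [n] the probability
    of a bad state is exponentially small in [n].  For [alpha < 1], a second look
    at [\sum_i v (x_i)] once [f] is small makes the stationary mean of [f] small. *)

Set Implicit Arguments.
Unset Strict Implicit.
Unset Printing Implicit Defensive.

(** * Exponential generating functions and differential inequalities *)

Section Calculus.
Variable R : realType.
Implicit Types (a : nat -> R) (t B M : R) (f df : R -> R).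

Lemma nincr_derive f df (a b : R) :
  (forall t, is_derive t 1 f (df t)) ->
  (forall t, a <= t -> t <= b -> df t <= 0) ->
  a <= b -> f b <= f a.
Proof.
move=> fd df0 ab.
apply: (@ler0_derive1_nincr R f a b) => // [x|].
- rewrite in_itv /= => /andP[/ltW ax /ltW xb].
  by rewrite derive1E (@derive_val _ _ _ _ _ _ _ (fd x)) df0.
- apply: continuous_subspaceT => x.
  by apply/differentiable_continuous/derivable1_diffP; have [] := fd x.
Qed.

Lemma le_derive f df g dg (a b : R) :
  (forall t, is_derive t 1 f (df t)) -> (forall t, is_derive t 1 g (dg t)) ->
  (forall t, a <= t -> t <= b -> df t <= dg t) ->
  f a <= g a -> a <= b -> f b <= g b.
Proof.
move=> fd gd dfg fga ab.
have H t : is_derive t 1 (f - g) (df t - dg t) by exact: is_deriveB.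
have := nincr_derive H (a := a) (b := b).
have -> : (f - g) b = f b - g b by [].
have -> : (f - g) a = f a - g a by [].
move=> K; have := K _ ab; rewrite -subr_le0 => K'.
have : f b - g b - (f a - g a) <= 0.
  by apply: K' => t at_ tb; rewrite subr_le0 dfg.
lra.
Qed.

(** With the integrating factor, [expR (lam * s) * (f s - eta / lam)] is nonincreasing from [T0] on.
    The inequality is asked only after [T0] because bad states become rare only after a burn-in. *)
Lemma gronwall f df (lam eta T0 : R) : 0 < lam -> 0 <= eta ->
  (forall t, is_derive t 1 f (df t)) ->
  (forall t, T0 <= t -> df t <= - lam * f t + eta) ->
  forall t, T0 <= t -> f t <= expR (- lam * (t - T0)) * f T0 + eta / lam.
Proof.
move=> lam0 eta0 fd dfle t Tt.
pose g (s : R) := expR (lam * s) * (f s - eta / lam).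
have gd (s : R) : is_derive s 1 g
    (expR (lam * s) * df s + (f s - eta / lam) * (lam * expR (lam * s))).
  rewrite /g.
  have H1 : is_derive s 1 (fun s : R => expR (lam * s)) (lam * expR (lam * s)).
    have := @is_derive1_comp R expR (fun s => lam * s) s _ lam.
    have H2 : is_derive s 1 (fun s : R => lam * s) lam.
      by apply: is_derive_eq; rewrite scaler1.
    by move=> H; have := H _ (is_derive_expR _) H2; rewrite mulrC.
  have H2 : is_derive s 1 (fun s : R => f s - eta / lam) (df s).
    by have fs := fd s; apply: is_derive_eq; rewrite subr0.
  exact: (is_deriveM H1 H2).
have : g t <= g T0.
  apply: (nincr_derive gd) => // s Ts st.
  have -> : expR (lam * s) * df s + (f s - eta / lam) * (lam * expR (lam * s))
     = expR (lam * s) * (df s + lam * (f s - eta / lam)) by ring.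
  rewrite pmulr_rle0 ?expR_gt0//.
  have := dfle s Ts.
  have -> : lam * (f s - eta / lam) = lam * f s - eta.
    by rewrite mulrBr mulrCA divff ?mulr1// gt_eqF.
  lra.
rewrite /g => H.
have E : expR (lam * t) = expR (lam * (t - T0)) * expR (lam * T0).
  by rewrite -expRD; congr expR; ring.
move: H; rewrite E -mulrA mulrCA ler_pM2l ?expR_gt0// => H.
have Ep := expR_gt0 (lam * (t - T0)).
have EN : expR (- lam * (t - T0)) = (expR (lam * (t - T0)))^-1.
  by rewrite mulNr expRN.
have : f t - eta / lam <= expR (- lam * (t - T0)) * (f T0 - eta / lam).
  by rewrite EN -(ler_pM2l Ep) mulVKf ?gt_eqF.
set e := expR (- _ * _) => H2.
have e0 : 0 <= e * (eta / lam) by rewrite mulr_ge0 ?expR_ge0// divr_ge0// ltW.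
lra.
Qed.

(** When [a k] is the value at a point of the [k]-th iterate of a bounded operator, [egf a t] below
    is the exponential of [t] times that operator; a geometric bound on [a] gives convergence for
    every [t]. *)
Definition geobound a M B := forall k, `|a k| <= M * B ^+ k.

Definition egf a t : R := limn (pseries (fun k => a k / k`!%:R) t).

Lemma geobound_shift a M B : geobound a M B ->
  geobound (fun k => a k.+1) (M * B) B.
Proof. by move=> H k; rewrite -mulrA -exprS. Qed.

Lemma cvg_egf a M B t : 0 <= M -> 0 <= B -> geobound a M B ->
  cvgn (pseries (fun k => `|a k / k`!%:R|) `|t|) /\
  limn (pseries (fun k => `|a k / k`!%:R|) `|t|) <= M * expR (B * `|t|).
Proof.
move=> M0 B0 aMB.
have le k : `|a k / k`!%:R| * `|t| ^+ k <= M * exp_coeff (B * `|t|) k.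
  rewrite normrM [`|_^-1|]ger0_norm ?invr_ge0 ?ler0n//.
  rewrite /exp_coeff /= exprMn -mulrA [_^-1 * _]mulrC !mulrA.
  by rewrite ler_wpM2r ?invr_ge0 ?ler0n// ler_wpM2r ?exprn_ge0.
have C2 : series (fun k => M * exp_coeff (B * `|t|) k) @ \oo --> M * expR (B * `|t|).
  rewrite (_ : series _ = (fun n => M * series (exp_coeff (B * `|t|)) n)).
    by apply: cvgMr; exact: is_cvg_series_exp_coeff.
  by apply/funext => n; rewrite /series /= mulr_sumr.
have C1 : cvgn (pseries (fun k => `|a k / k`!%:R|) `|t|).
  apply: (@series_le_cvg _ _ (fun k => M * exp_coeff (B * `|t|) k)) => //.
  - by move=> k; rewrite mulr_ge0// exprn_ge0.
  - by move=> k; rewrite mulr_ge0// exp_coeff_ge0// mulr_ge0.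
  - by apply/cvg_ex; eexists; exact: C2.
split=> //.
rewrite -(cvg_lim _ C2)//.
by apply: lim_series_le => //; apply/cvg_ex; eexists; exact: C2.
Qed.

Lemma egfP a M B t : 0 <= M -> 0 <= B -> geobound a M B ->
  cvgn (pseries (fun k => a k / k`!%:R) t) /\ `|egf a t| <= M * expR (B * `|t|).
Proof.
move=> M0 B0 aMB.
have [C1 C2] := cvg_egf t M0 B0 aMB.
have E : [normed series (fun k => a k / k`!%:R * t ^+ k)] =
         pseries (fun k => `|a k / k`!%:R|) `|t|.
  by apply/funext => n; rewrite /pseries /series /=; apply: eq_bigr => i _;
     rewrite normrM normrX.
have cn : cvgn [normed series (fun k => a k / k`!%:R * t ^+ k)] by rewrite E.
split; first exact: normed_cvg.
apply: le_trans (lim_series_norm cn) _.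
by rewrite E.
Qed.

Lemma is_cvg_egf a M B t : 0 <= M -> 0 <= B -> geobound a M B ->
  cvgn (pseries (fun k => a k / k`!%:R) t).
Proof. by move=> M0 B0 /(egfP t M0 B0)[]. Qed.

Lemma egf_le a M B t : 0 <= M -> 0 <= B -> geobound a M B ->
  `|egf a t| <= M * expR (B * `|t|).
Proof. by move=> M0 B0 /(egfP t M0 B0)[]. Qed.

(** Dividing by [k!] turns differentiation into a shift of the coefficients: differentiating in time
    amounts to applying the operator once more. *)
Lemma egf_diffs a :
  pseries_diffs (fun k => a k / k`!%:R) = fun k => a k.+1 / k`!%:R.
Proof.
apply/funext => k; rewrite /pseries_diffs factS natrM invfM.
by rewrite mulrCA !mulrA mulfK// ?pnatr_eq0.
Qed.

Lemma is_derive_egf a M B t : 0 <= M -> 0 <= B -> geobound a M B ->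
  is_derive t 1 (egf a) (egf (fun k => a k.+1) t).
Proof.
move=> M0 B0 aMB; rewrite /egf -egf_diffs.
have a1 := geobound_shift aMB; have a2 := geobound_shift a1.
have M1 : 0 <= M * B by exact: mulr_ge0.
have M2 : 0 <= M * B * B by exact: mulr_ge0.
apply: (@pseries_snd_diffs _ _ (`|t| + 1)).
- exact: is_cvg_egf aMB.
- by rewrite egf_diffs; apply: is_cvg_egf a1.
- by rewrite !egf_diffs; apply: is_cvg_egf a2.
- by rewrite [ltRHS]ger0_norm// ltrDl.
Qed.

Lemma egf0 a : egf a 0 = a 0%N.
Proof.
apply: (@lim_near_cst R^o) => //; near=> n.
have -> : n = n.-1.+1 by rewrite prednK//; near: n; exists 1%N.
rewrite /pseries /series /= big_nat_recl// big1 => [|i _].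
  by rewrite addr0 expr0 mulr1 fact0 divr1.
by rewrite expr0n mulr0.
Unshelve. all: by end_near. Qed.

Lemma egfD a b M N B t : 0 <= M -> 0 <= N -> 0 <= B ->
  geobound a M B -> geobound b N B ->
  forall c, egf (fun k => c * a k + b k) t = c * egf a t + egf b t.
Proof.
move=> M0 N0 B0 aM bN c; apply: cvg_lim => //.
rewrite (_ : pseries _ t = c \*: pseries (fun k => a k / k`!%:R) t
            + pseries (fun k => b k / k`!%:R) t).
  apply: cvgD; first apply: cvgZr.
  - exact: is_cvg_egf aM.
  - exact: is_cvg_egf bN.
apply/funext => n.
transitivity (c * (\sum_(0 <= k < n) a k / k`!%:R * t ^+ k)
              + \sum_(0 <= k < n) b k / k`!%:R * t ^+ k); last by [].
rewrite mulr_sumr -big_split /=.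
by apply: eq_bigr => i _ /=; ring.
Qed.

Lemma egf_ge0 a M B t : 0 <= M -> 0 <= B -> geobound a M B ->
  (forall k, 0 <= a k) -> 0 <= t -> 0 <= egf a t.
Proof.
move=> M0 B0 aM a0 t0; apply: limr_ge; first exact: is_cvg_egf aM.
near=> n; rewrite /pseries /series /=; apply: sumr_ge0 => i _.
by rewrite !mulr_ge0 ?invr_ge0 ?exprn_ge0.
Unshelve. all: by end_near. Qed.

(** From [1 - z <= expR (- z)]: after multiplication by [1 - z > 0] the claim reduces to
    [0 <= z ^+ 2 * (1 - 2 * z)]. *)
Lemma expR_quad (z : R) : `|z| <= 1 / 2 -> expR z - 1 <= z + 2 * z ^+ 2.
Proof.
rewrite ler_norml => /andP[z1 z2].
have := expR_ge1Dx (- z); rewrite expRN => H.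
have e0 := expR_gt0 z.
have {}H : (1 - z) * expR z <= 1 by rewrite -ler_pdivlMr// mul1r.
have : (1 - z) * (expR z - 1 - z - 2 * z ^+ 2) <= 0.
  have -> : (1 - z) * (expR z - 1 - z - 2 * z ^+ 2) =
    ((1 - z) * expR z - 1) - z ^+ 2 * (1 - 2 * z) by ring.
  have : 0 <= z ^+ 2 * (1 - 2 * z) by rewrite mulr_ge0 ?sqr_ge0//; lra.
  lra.
rewrite pmulr_rle0; [lra | lra].
Qed.

(** One term of the exponential series. Cubic decay in [n] beats prefactors of order [n ^+ 2] and
    still leaves [1 / n]. *)
Lemma expR_cube (z : R) : 0 < z -> expR (- z) <= 6 / z ^+ 3.
Proof.
move=> z0; have z3 : 0 < z ^+ 3 by exact: exprn_gt0.
rewrite ler_pdivlMr// expRN mulrC ler_pdivrMr ?expR_gt0//.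
have := expR_ge1Dxn 2 (ltW z0); rewrite (_ : 3`! = 6)%N// => H.
have : z ^+ 3 / 6 <= expR z by lra.
by rewrite ler_pdivrMr// mulrC.
Qed.

Lemma large_nat (C eps : R) : 0 < eps ->
  exists n0 : nat, forall n : nat, (n0 <= n)%N -> (1 <= n)%N -> C / n%:R <= eps.
Proof.
move=> eps0; exists (Num.bound `|C / eps|) => n le n1.
have n0 : 0 < n%:R :> R by rewrite ltr0n.
rewrite ler_pdivrMr// -ler_pdivrMl// mulrC.
apply: le_trans (ler_norm _) _; apply/ltW.
by apply: lt_le_trans (archi_boundP (normr_ge0 _)) _; rewrite ler_nat.
Qed.

Lemma pow_small (x eps : R) : 0 <= x -> x < 1 -> 0 < eps ->
  exists N : nat, forall n, (N <= n)%N -> x ^+ n <= eps.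
Proof.
move=> x0 x1 eps0.
have cx : (GRing.exp x : nat -> R) @ \oo --> (0 : R).
  by apply: cvg_expr; rewrite ger0_norm.
have /cvgrPdist_le /(_ _ eps0) [N _ HN] := cx.
exists N => n Nn; have := HN n Nn; rewrite /= sub0r normrN.
by rewrite ger0_norm// exprn_ge0.
Qed.

Lemma pow_lin_small (x eps : R) : 0 <= x -> x < 1 -> 0 < eps ->
  exists N : nat, forall n, (N <= n)%N -> n.+1%:R * x ^+ n <= eps.
Proof.
(* With [x ^+ n = y ^+ n * y ^+ n], one factor keeps [n.+1%:R * y ^+ n] below [1 / (1 - y)], by
   comparison with the geometric sum, and the other tends to 0. *)
move=> x0 x1 eps0; pose y := Num.sqrt x.
have y0 : 0 <= y by exact: sqrtr_ge0.
have y2 : y ^+ 2 = x by rewrite sqr_sqrtr.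
have y1 : y < 1 by rewrite -(expr_lt1 (n := 2))// y2.
have H n : n.+1%:R * y ^+ n * (1 - y) <= 1 - y ^+ n.+1.
  elim: n => [|n IH]; first by rewrite expr0 mulr1 mul1r expr1.
  have yn : y ^+ n.+1 * (1 - y) <= 1 * (1 - y).
    by apply: ler_wpM2r; [rewrite subr_ge0 ltW | rewrite exprn_ile1// ltW].
  have := ler_wpM2l y0 IH.
  have -> : y * (n.+1%:R * y ^+ n * (1 - y)) = n.+1%:R * y ^+ n.+1 * (1 - y).
    by rewrite exprS; ring.
  have -> : n.+2%:R * y ^+ n.+1 * (1 - y) =
     n.+1%:R * y ^+ n.+1 * (1 - y) + y ^+ n.+1 * (1 - y) by rewrite -natr1; ring.
  have -> : y * (1 - y ^+ n.+1) = y - y ^+ n.+2 by rewrite mulrBr mulr1 -exprS.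
  have e : y ^+ n.+1 * (1 - y) = y ^+ n.+1 - y ^+ n.+2 by rewrite mulrBr mulr1 -exprSr.
  move: yn; rewrite e; lra.
have y10 : 0 < 1 - y by rewrite subr_gt0.
have [N HN] := pow_small y0 y1 (mulr_gt0 eps0 y10).
exists N => n Nn.
rewrite -(ler_pM2r y10) -y2 exprAC expr2 !mulrA.
apply: le_trans (HN n Nn).
have -> : n.+1%:R * y ^+ n * y ^+ n * (1 - y) = n.+1%:R * y ^+ n * (1 - y) * y ^+ n by ring.
rewrite ler_piMl ?exprn_ge0//; apply: le_trans (H n) _.
by rewrite lerBlDr lerDl exprn_ge0.
Qed.

(** Either the bracket is nonpositive, or [p] lies below [K] by an amount linear in [K], and then
    the geometric factor beats the linear one. This controls every one-link drift in the subcritical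
    regime. *)
Lemma geo_peak (rho beta A tau : R) : 0 <= rho -> rho < 1 -> beta < 1 -> 0 < A ->
  0 < tau -> exists K0 : nat, forall K p, (K0 <= K)%N -> (p <= K)%N ->
    rho ^+ (K - p) * (A * (beta * K%:R - p%:R) + 1) <= tau.
Proof.
move=> rho0 rho1 beta1 A0 tau0.
have A1 : 0 < A + 1 by rewrite addr_gt0.
have [k0 Hk0] := pow_lin_small rho0 rho1 (divr_gt0 tau0 A1).
have b0 : 0 < 1 - beta by rewrite subr_gt0.
(* For [K >= B], a positive bracket forces [K - p >= k0]. *)
pose B := (k0%:R + A^-1) / (1 - beta).
exists (Num.bound `|B|) => K p KB pK.
have HB : B <= K%:R.
  apply: le_trans (ler_norm _) _; apply/ltW.
  by apply: lt_le_trans (archi_boundP (normr_ge0 _)) _; rewrite ler_nat.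
move: HB; rewrite ler_pdivrMr// => HB.
have kE : (K - p)%:R = K%:R - p%:R :> R by rewrite natrB.
set k := (K - p)%N in kE *.
have rk : 0 <= rho ^+ k by exact: exprn_ge0.
have [neg|pos] := lerP (A * (beta * K%:R - p%:R) + 1) 0.
  by apply: le_trans (ltW tau0); rewrite mulr_ge0_le0.
have kk0 : (k0 <= k)%N.
  rewrite -(ler_nat R) kE.
  have : 0 < A^-1 * (A * (beta * K%:R - p%:R) + 1) by rewrite mulr_gt0// invr_gt0.
  rewrite mulrDr mulr1 mulKf ?gt_eqF//; lra.
have := Hk0 k kk0; rewrite ler_pdivlMr// => H.
apply: le_trans H; rewrite mulrAC mulrC ler_wpM2r//.
have k1 : (k.+1%:R : R) = K%:R - p%:R + 1 by rewrite -natr1 kE.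
have bK : A * (beta * K%:R - p%:R) <= A * (K%:R - p%:R).
  rewrite ler_pM2l//; have : beta * K%:R <= 1 * K%:R by rewrite ler_wpM2r// ltW.
  lra.
have : 0 <= (k%:R : R) by [].
rewrite k1 kE; lra.
Qed.

End Calculus.

(** * Markov semigroups *)

Section Semigroup.
Variable R : realType.

Definition semi (S : Type) (T : (S -> R) -> S -> R) (t : R) (u : S -> R)
  (x : S) : R := egf (fun k => iter k T u x) t.

(** Abstract bounded Markov generator: [c] dominates the total jump rate, so that [T + c] preserves
    nonnegativity. One theory then serves the chain and its coupling. *)
Record markov_gen (S : Type) (T : (S -> R) -> S -> R) (c : R) : Prop := {
  mg_c0 : 0 <= c;
  mg_lin : forall a u v, T (fun z => a * u z + v z) = fun x => a * T u x + T v x;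
  mg_one : T (fun=> 1) = fun=> 0;
  mg_pos : forall u, (forall x, 0 <= u x) -> forall x, 0 <= T u x + c * u x }.

Variables (S : Type) (T : (S -> R) -> S -> R) (c : R).
Hypothesis TG : markov_gen T c.
Let c0 := mg_c0 TG.
Implicit Types (u v : S -> R) (M t : R) (x : S).

Let c20 : 0 <= 2 * c. Proof. by rewrite mulr_ge0// mg_c0. Qed.

Lemma markov_gen0 : T (fun=> 0) = fun=> 0.
Proof.
apply/funext => x.
have -> : (fun=> 0) = (fun z : S => (-1) * (fun=> 1) z + (fun=> 1) z) :> (S -> R).
  by apply/funext => z; ring.
by rewrite (mg_lin TG) (mg_one TG); ring.
Qed.

Lemma markov_genM a u : T (fun z => a * u z) = fun x => a * T u x.
Proof.
have -> : (fun z => a * u z) = (fun z => a * u z + (fun=> 0) z).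
  by apply/funext => z; rewrite addr0.
by rewrite (mg_lin TG) markov_gen0; apply/funext => z; rewrite addr0.
Qed.

Lemma markov_gen_cst a : T (fun=> a) = fun=> 0.
Proof.
have -> : (fun=> a) = (fun z : S => a * (fun=> 1) z).
  by apply/funext => z; rewrite mulr1.
by rewrite markov_genM (mg_one TG); apply/funext => z; rewrite mulr0.
Qed.

(** Positivity applied to [M - u]. It is also the crude drift bound used in bad states. *)
Lemma markov_gen_le u M : (forall x, u x <= M) ->
  forall x, T u x <= c * (M - u x).
Proof.
move=> uM x.
have H : forall z, 0 <= (-1) * u z + (fun=> M) z.
  by move=> z; rewrite mulN1r addrC subr_ge0.
have := mg_pos TG H x; rewrite (mg_lin TG) markov_gen_cst; lra.
Qed.

Let A u x := T u x + c * u x.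

Let A_bound u M : (forall x, `|u x| <= M) -> forall x, `|A u x| <= c * M.
Proof.
move=> uM x; rewrite /A ler_norml.
have u1 z : u z <= M by have := uM z; rewrite ler_norml => /andP[].
have u2 z : (-1) * u z <= M.
  by have := uM z; rewrite ler_norml => /andP[]; lra.
have := markov_gen_le u1 x; have := markov_gen_le u2 x.
rewrite markov_genM => *; apply/andP; split; lra.
Qed.

Let T_bound u M : (forall x, `|u x| <= M) -> forall x, `|T u x| <= 2 * c * M.
Proof.
move=> uM x; have H := A_bound uM x.
have -> : T u x = A u x - c * u x by rewrite /A addrK.
apply: le_trans (ler_normB _ _) _.
rewrite normrM (ger0_norm c0).
have : c * `|u x| <= c * M by rewrite ler_wpM2l.
lra.
Qed.

Let iter_bound (B : (S -> R) -> S -> R) b u M :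
  (forall u M, (forall x, `|u x| <= M) -> forall x, `|B u x| <= b * M) ->
  (forall x, `|u x| <= M) -> forall x, geobound (fun k => iter k B u x) M b.
Proof.
move=> HB uM x k; elim: k x => [|k IH] x; first by rewrite expr0 mulr1.
by rewrite iterS exprS mulrCA; apply: HB.
Qed.

Let iter_lin (B : (S -> R) -> S -> R) a u v k :
  (forall a u v, B (fun z => a * u z + v z) = fun x => a * B u x + B v x) ->
  iter k B (fun z => a * u z + v z) =
    fun x => a * iter k B u x + iter k B v x.
Proof. by move=> HB; elim: k => [//|k IH]; rewrite !iterS IH HB. Qed.

Let A_lin a u v : A (fun z => a * u z + v z) = fun x => a * A u x + A v x.
Proof. by apply/funext => x; rewrite /A (mg_lin TG); ring. Qed.

Lemma semi0 u x : semi T 0 u x = u x.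
Proof. by rewrite /semi egf0. Qed.

Section Bounded.
Variables (u : S -> R) (M : R).
Hypothesis uM : forall x, `|u x| <= M.

Let M0 x : 0 <= M. Proof. exact: le_trans (uM x). Qed.

Lemma geobound_semi x : geobound (fun k => iter k T u x) M (2 * c).
Proof. exact: iter_bound T_bound uM x. Qed.

Lemma is_derive_semi x t : is_derive t 1 (fun t => semi T t u x) (semi T t (T u) x).
Proof.
rewrite /semi.
have -> : (fun k => iter k T (T u) x) = (fun k => iter k.+1 T u x).
  by apply/funext => k; rewrite iterSr.
exact: is_derive_egf (M0 x) c20 (geobound_semi x).
Qed.

Lemma semi_lin a v N x t : (forall x, `|v x| <= N) ->
  semi T t (fun z => a * u z + v z) x = a * semi T t u x + semi T t v x.
Proof.
move=> vN; rewrite /semi.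
rewrite -(@egfD R _ _ M N (2 * c))//.
- by congr egf; apply/funext => k; rewrite iter_lin//; exact: mg_lin TG.
- exact: M0.
- exact: le_trans (vN x).
- exact: geobound_semi.
- exact: iter_bound T_bound vN x.
Qed.

End Bounded.

(** A second expression for the semigroup, positivity preserving for [t >= 0]; the difference [D] of
    the two is shown to vanish. *)
Let E u t x := expR (- c * t) * egf (fun k => iter k A u x) t.
Let D u t x := semi T t u x - E u t x.

Let dD u M x t : (forall x, `|u x| <= M) ->
  is_derive t 1 (fun t => D u t x) (D (T u) t x).
Proof.
move=> uM; rewrite /D.
have M0 : 0 <= M by exact: le_trans (uM x).
have AM z : geobound (fun k => iter k A u z) M c by exact: iter_bound A_bound uM z.
have H1 := is_derive_semi uM x t.
have H2 := is_derive_egf t M0 c0 (AM x).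
have H3 : is_derive t 1 (fun s : R => expR (- c * s)) (- c * expR (- c * t)).
  have H4 : is_derive t 1 (fun s : R => - c * s) (- c).
    by apply: is_derive_eq; rewrite scaler1.
  have := @is_derive1_comp R expR (fun s => - c * s) t _ (- c).
  by move=> H; have := H _ (is_derive_expR _) H4; rewrite mulrC.
have H4 := is_deriveM H3 H2.
have H5 := is_deriveB H1 H4.
apply: is_derive_eq H5 _.
have e1 : (fun k => iter k.+1 A u x) =
    (fun k => c * iter k A u x + iter k A (T u) x).
  apply/funext => k; rewrite iterSr.
  have -> : A u = fun z => c * u z + T u z.
    by apply/funext => z; rewrite /A addrC.
  by rewrite iter_lin.
rewrite e1 (@egfD R _ _ M (2 * c * M) c)//; last 2 first.
- by rewrite mulr_ge0.
- exact: iter_bound A_bound (T_bound uM) x.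
by rewrite /E /GRing.scale /=; ring.
Qed.

(** The time derivative of [D u] is [D (T u)], where [T u] is bounded by [2 * c * M], and [D]
    vanishes at time 0. Integrating [k] times gains [(2 * c * t) ^+ k / k!], which tends to 0 in
    [k]. *)
Let D_bound (t0 : R) : 0 <= t0 -> forall k u M, (forall x, `|u x| <= M) ->
  forall t x, 0 <= t -> t <= t0 ->
  `|D u t x| <= (expR (2 * c * t0) + 1) * M * (2 * c * t) ^+ k / k`!%:R.
Proof.
move=> t00; elim=> [|k IH] u M uM t x t_0 tt0.
  have M0 : 0 <= M by exact: le_trans (uM x).
  rewrite expr0 mulr1 fact0 divr1 /D.
  apply: le_trans (ler_normB _ _) _; rewrite mulrDl mul1r.
  apply: lerD.
    apply: le_trans (egf_le t M0 c20 (geobound_semi uM x)) _.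
    by rewrite mulrC ler_wpM2r// ler_expR ler_wpM2l// ger0_norm.
  rewrite /E normrM ger0_norm ?expR_ge0//.
  have AM : geobound (fun k => iter k A u x) M c by exact: iter_bound A_bound uM x.
  have := egf_le t M0 c0 AM; rewrite [`|t|]ger0_norm// => H.
  apply: le_trans (ler_wpM2l (expR_ge0 _) H) _.
  by rewrite mulrCA -expRD mulNr addNr expR0 mulr1.
set C := expR _ + 1 in IH *.
have C0 : 0 <= C by rewrite addr_ge0// expR_ge0.
pose g (s : R) := C * M * (2 * c * s) ^+ k.+1 / k.+1`!%:R.
pose dg (s : R) := C * (2 * c * M) * (2 * c * s) ^+ k / k`!%:R.
have gd (s : R) : is_derive s 1 g (dg s).
  have H := is_deriveZ (C * M * (2 * c) ^+ k.+1 / k.+1`!%:R)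
    (is_deriveX k.+1 (is_derive_id s 1)).
  have <- : (C * M * (2 * c) ^+ k.+1 / k.+1`!%:R) \*: (@idfun R) ^+ k.+1 = g.
    apply/funext => z.
    transitivity ((C * M * (2 * c) ^+ k.+1 / k.+1`!%:R) * ((@idfun R) ^+ k.+1) z) => //.
    by rewrite exprfctE /g [(_ * z) ^+ _]exprMn /=; ring.
  apply: (is_derive_eq H).
  rewrite /dg factS natrM invfM [(_ * s) ^+ _]exprMn exprS /GRing.scale /=.
  have k0 : (k`!%:R : R) != 0 by rewrite pnatr_eq0 -lt0n fact_gt0.
  have k1 : (k.+1%:R : R) != 0 by rewrite pnatr_eq0.
  by field; rewrite k0 nat1r.
have TM := T_bound uM.
rewrite ler_norml; apply/andP; split.
  rewrite -lerN2 opprK.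
  have dDN (s : R) : is_derive s 1 (fun s => - D u s x) (- D (T u) s x).
    by apply: is_deriveN; exact: dD uM.
  apply: (le_derive dDN gd _ _ t_0) => /=.
    move=> s s0 st; apply: le_trans (IH _ _ TM s x s0 (le_trans st tt0)).
    by rewrite -normrN ler_norm.
  by rewrite /g /D /E semi0 egf0 mulr0 expR0 mul1r subrr oppr0 mulr0 expr0n
     mulr0 mul0r.
apply: (le_derive (fun s => dD x s uM) gd _ _ t_0) => /=.
  move=> s s0 st; apply: le_trans (IH _ _ TM s x s0 (le_trans st tt0)).
  by rewrite ler_norm.
by rewrite /g /D /E semi0 egf0 mulr0 expR0 mul1r subrr mulr0 expr0n
   mulr0 mul0r.
Qed.

(* T + c is entrywise nonnegative and exp (t T) = exp (- c t) exp (t (T + c)). *)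
Lemma semi_ge0 u M t x : (forall x, `|u x| <= M) -> (forall x, 0 <= u x) ->
  0 <= t -> 0 <= semi T t u x.
Proof.
move=> uM u0 t0.
have M0 : 0 <= M by exact: le_trans (uM x).
have AM : geobound (fun k => iter k A u x) M c by exact: iter_bound A_bound uM x.
have -> : semi T t u x = E u t x.
  apply/eqP; rewrite -subr_eq0 -normr_le0 -/(D u t x).
  set C := (expR (2 * c * t) + 1) * M.
  have cvC : (fun k => C * exp_coeff (2 * c * t) k) @ \oo --> C * 0.
    by apply: cvgMr; exact: cvg_exp_coeff.
  rewrite -(mulr0 C) -(cvg_lim _ cvC)//.
  apply: limr_ge; first by apply/cvg_ex; eexists; exact: cvC.
  near=> k; apply: le_trans (D_bound t0 k uM x t0 (lexx t)) _.
  by rewrite /exp_coeff /= /C !mulrA.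
rewrite /E mulr_ge0 ?expR_ge0//; apply: egf_ge0 AM _ t0 => // k.
elim: k x => [|k IH] x //=.
exact: (mg_pos TG IH x).
Unshelve. all: by end_near. Qed.

Lemma semi_cst a t x : semi T t (fun=> a) x = a.
Proof.
apply: (@lim_near_cst R^o) => //; near=> n.
have -> : n = n.-1.+1 by rewrite prednK//; near: n; exists 1%N.
rewrite /pseries /series /= big_nat_recl// big1 => [|i _].
  by rewrite addr0 expr0 mulr1 fact0 divr1.
suff -> : iter i.+1 T (fun=> a) = fun=> 0 by rewrite !mul0r.
by rewrite iterSr markov_gen_cst; elim: i => //= i ->; exact: markov_gen0.
Unshelve. all: by end_near. Qed.

Lemma semi_mono u v M N t x : (forall x, `|u x| <= M) -> (forall x, `|v x| <= N) ->
  (forall x, u x <= v x) -> 0 <= t -> semi T t u x <= semi T t v x.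
Proof.
move=> uM vN uv t0.
rewrite -subr_ge0 addrC -mulN1r -(semi_lin uM _ _ _ vN).
apply: (@semi_ge0 _ (M + N)) => // z; last by rewrite mulN1r addrC subr_ge0.
apply: le_trans (ler_normD _ _) _; rewrite normrM normrN1 mul1r.
exact: lerD.
Qed.

Lemma semi_le_cst u M N t x : (forall x, `|u x| <= M) -> (forall x, u x <= N) ->
  0 <= t -> semi T t u x <= N.
Proof.
move=> uM uN t0; rewrite -[leRHS](semi_cst N t x).
exact: (semi_mono _ uM (fun=> lexx `|N|)).
Qed.

End Semigroup.

(** * Semigroups on a finite state space, where every function is bounded *)

Section FiniteSemigroup.
Variable R : realType.

Lemma fin_bound (S : finType) (u : S -> R) : exists M, forall x, `|u x| <= M.
Proof.
exists (\sum_z `|u z|) => x; rewrite (bigD1 x)//= lerDl.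
by apply: sumr_ge0.
Qed.

Variables (S : finType) (T : (S -> R) -> S -> R) (c : R).
Hypothesis TG : markov_gen T c.

Lemma fsemi_mono u v t x : 0 <= t -> (forall x, u x <= v x) ->
  semi T t u x <= semi T t v x.
Proof.
move=> t0 uv; have [M uM] := fin_bound u; have [N vN] := fin_bound v.
exact: (semi_mono TG _ uM vN).
Qed.

Lemma fsemi_lin a u v t x :
  semi T t (fun z => a * u z + v z) x = a * semi T t u x + semi T t v x.
Proof.
have [M uM] := fin_bound u; have [N vN] := fin_bound v.
exact: (semi_lin TG uM _ _ _ vN).
Qed.

Lemma fsemiD u v t x :
  semi T t (fun z => u z + v z) x = semi T t u x + semi T t v x.
Proof.
rewrite -[semi T t u x]mul1r -fsemi_lin.
by congr semi; apply/funext => z; rewrite mul1r.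
Qed.

Lemma fsemiM a u t x : semi T t (fun z => a * u z) x = a * semi T t u x.
Proof.
rewrite -[RHS]addr0 -(semi_cst TG 0 t x) -fsemi_lin.
by congr semi; apply/funext => z; rewrite addr0.
Qed.

Lemma fsemi_sum (I : finType) (P : pred I) (F : I -> S -> R) t x :
  semi T t (fun z => \sum_(i | P i) F i z) x = \sum_(i | P i) semi T t (F i) x.
Proof.
have H (r : seq I) : semi T t (fun z => \sum_(i <- r | P i) F i z) x =
    \sum_(i <- r | P i) semi T t (F i) x.
  elim: r => [|i r IH].
    rewrite big_nil -[RHS](semi_cst TG 0 t x).
    by congr semi; apply/funext => z; rewrite big_nil.
  rewrite big_cons -IH; case: (boolP (P i)) => Pi.
    rewrite -fsemiD; congr semi; apply/funext => z.
    by rewrite big_cons Pi.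
  by congr semi; apply/funext => z; rewrite big_cons (negbTE Pi).
exact: H.
Qed.

(** The drift inequality may fail by [D] in some states: only the mean of [D] along the process has
    to be small, and only after [T0]. *)
Lemma fsemi_gronwall (F D : S -> R) (lam eta T0 : R) x :
  0 < lam -> 0 <= eta -> 0 <= T0 ->
  (forall z, T F z <= - lam * F z + D z) ->
  (forall t, T0 <= t -> semi T t D x <= eta) ->
  forall t, T0 <= t ->
    semi T t F x <= expR (- lam * (t - T0)) * semi T T0 F x + eta / lam.
Proof.
move=> lam0 eta0 T00 TF Deta t tT.
have [M FM] := fin_bound F.
apply: (gronwall lam0 eta0 (fun t => is_derive_semi TG FM x t)) tT => s sT.
have s0 : 0 <= s by exact: le_trans sT.
apply: le_trans (fsemi_mono _ s0 TF) _.
by rewrite fsemi_lin lerD2l; exact: Deta.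
Qed.

End FiniteSemigroup.

(** * Jump generators, transition matrices and mixing times *)

Section Jump.
Variable R : realType.

(** Indexed by events instead of target states: distinct events may share a target, and an event
    that leaves the state fixed contributes 0. Couplings are naturally written this way. *)
Definition jump (S : Type) (E : finType) (rate : E -> S -> R) (move : E -> S -> S)
  (u : S -> R) (x : S) : R := \sum_e rate e x * (u (move e x) - u x).

Lemma jump_markov (S : Type) (E : finType) (rate : E -> S -> R)
    (move : E -> S -> S) (c : R) :
  0 <= c -> (forall e x, 0 <= rate e x) -> (forall x, \sum_e rate e x <= c) ->
  markov_gen (jump rate move) c.
Proof.
move=> c0 r0 rc; split=> //.
- move=> a u v; apply/funext => x; rewrite /jump mulr_sumr -big_split /=.
  by apply: eq_bigr => e _; ring.
- by apply/funext => x; rewrite /jump big1// => e _; rewrite subrr mulr0.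
- move=> u u0 x; rewrite /jump.
  apply: (@le_trans _ _ (\sum_e rate e x * (u (move e x) - u x) +
    (\sum_e rate e x) * u x)); last by rewrite lerD2l ler_wpM2r.
  rewrite mulr_suml -big_split /=; apply: sumr_ge0 => e _.
  by rewrite -mulrDr subrK mulr_ge0.
Qed.

Definition qgen (S : finType) (q : S -> S -> R) (u : S -> R) (x : S) : R :=
  \sum_z q x z * (u z - u x).

Lemma transitionE (S : finType) (q : S -> S -> R) t x y :
  transition q t x y = semi (qgen q) t (fun z => (z == y)%:R) x.
Proof.
rewrite /transition /expmx mxE /semi /egf; congr (lim (_ @ \oo)).
rewrite /pseries; congr series; apply/funext => k /=.
have -> : (t *: generator q) ^+ k = t ^+ k *: generator q ^+ k.
  elim: k => [|k IH]; first by rewrite !expr0 scale1r.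
  rewrite !exprS IH.
  transitivity ((t *: generator q) *m (t ^+ k *: generator q ^+ k)) => //.
  by rewrite -scalemxAl -scalemxAr scalerA.
rewrite mxE [RHS]mulrAC; congr (_ / _); rewrite mulrC; congr (_ * _).
(* Left multiplication by the generator matrix acts on each column as [qgen]: the diagonal entry
   supplies the terms [- u x]. *)
have HG (A : 'M[R]_#|S|) i j : (generator q *m A) i j =
    qgen q (fun z => A (enum_rank z) j) (enum_val i).
  rewrite mxE (bigD1 i)//= mxE eqxx /qgen.
  rewrite [RHS](bigD1 (enum_val i))//= subrr mulr0 add0r.
  under [RHS]eq_bigr do rewrite mulrBr.
  rewrite [RHS]big_split /= addrC; congr (_ + _).
    rewrite (reindex_onto (@enum_val S predT) enum_rank); last first.
      by move=> z _; rewrite enum_rankK.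
    apply: eq_big => [l|l li]; first by rewrite enum_valK eqxx andbT (inj_eq enum_val_inj).
    by rewrite mxE enum_valK eq_sym (negbTE li).
  by rewrite mulNr mulr_suml -sumrN; apply: eq_bigr => z _; rewrite enum_valK.
elim: k x => [|k IH] x.
  have -> : generator q ^+ 0 = 1%:M by [].
  by rewrite mxE /= (inj_eq enum_rank_inj).
rewrite exprS.
have -> : generator q * generator q ^+ k = generator q *m generator q ^+ k by [].
rewrite HG enum_rankK iterS; congr qgen.
by apply/funext => z; exact: IH.
Qed.

Lemma transition_sum (S : finType) (q : S -> S -> R) c t x (A : {set S}) :
  markov_gen (qgen q) c ->
  \sum_(y in A) transition q t x y = semi (qgen q) t (fun z => (z \in A)%:R) x.
Proof.
move=> G; under eq_bigr do rewrite transitionE.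
rewrite -(fsemi_sum G); congr semi; apply/funext => z.
case: (boolP (z \in A)) => zA.
  rewrite (bigD1 z)//= eqxx big1 ?addr0// => y /andP[_ yz].
  by rewrite eq_sym (negbTE yz).
rewrite big1// => y yA; case: eqP => // zy; by rewrite zy yA in zA.
Qed.

Lemma invariant_semi (S : finType) (q : S -> S -> R) c t Pi (u : S -> R) :
  markov_gen (qgen q) c -> is_invariant q Pi -> 0 <= t ->
  \sum_x Pi x * semi (qgen q) t u x = \sum_x Pi x * u x.
Proof.
move=> G [_ inv] t0.
have E x : semi (qgen q) t u x = \sum_y transition q t x y * u y.
  under eq_bigr do rewrite transitionE mulrC -(fsemiM G).
  rewrite -(fsemi_sum G); congr semi; apply/funext => z.
  rewrite (bigD1 z)//= eqxx mulr1 big1 ?addr0// => y yz.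
  by rewrite eq_sym (negbTE yz) mulr0.
under eq_bigr do rewrite E mulr_sumr.
rewrite exchange_big /=; apply: eq_bigr => y _.
rewrite -(inv t t0 y) mulr_suml; apply: eq_bigr => x _.
by rewrite mulrA.
Qed.

(** By invariance [Pi] is the average over [y] drawn from [Pi] of the law started at [y], so
    comparing any two starting points is enough. *)
Lemma tv_dist_le (S : finType) (q : S -> S -> R) c t Pi eps :
  markov_gen (qgen q) c -> is_invariant q Pi -> 0 <= t -> 0 <= eps ->
  (forall (A : {set S}) x y, semi (qgen q) t (fun z => (z \in A)%:R) x
     - semi (qgen q) t (fun z => (z \in A)%:R) y <= eps) ->
  (tmix q Pi eps <= t%:E)%E.
Proof.
move=> G inv t0 eps0 H; apply: ereal_inf_lbound; exists t => //; split=> //.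
apply/bigmax_leP; split=> // x _; apply/bigmax_leP; split=> // A _.
rewrite (transition_sum _ _ _ G).
have -> : \sum_(y in A) Pi y = \sum_y Pi y * semi (qgen q) t (fun z => (z \in A)%:R) y.
  rewrite (invariant_semi _ G inv t0) big_mkcond /=; apply: eq_bigr => y _.
  by case: ifP => _; rewrite ?mulr1 ?mulr0.
have [[Pi0 Pi1] _] := inv.
set F := semi _ _ _.
rewrite -[F x]mul1r -Pi1 mulr_suml -sumrB.
apply: le_trans (ler_norm_sum _ _ _) _.
apply: (@le_trans _ _ (\sum_y Pi y * eps)); last by rewrite -mulr_suml Pi1 mul1r.
apply: ler_sum => y _; rewrite -mulrBr normrM (ger0_norm (Pi0 y)) ler_wpM2l//.
rewrite ler_norml; apply/andP; split; last exact: H.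
by rewrite lerNl opprB; exact: H.
Qed.

End Jump.

(** * The network and its coupling *)

Lemma sum_bool (R : nmodType) (f : bool -> R) : \sum_b f b = f true + f false.
Proof. by rewrite big_bool. Qed.

Section Network.
Variables (R : realType) (alpha : R) (sigma K : nat).
Hypothesis alpha_gt0 : 0 < alpha.

(** The moves are total: at the ends of the range they leave the link in place, and there
    [link_rate] is 0. *)
Definition link_move (b : bool) (p : nat) : nat :=
  if b then minn K p.+1 else p.-1.

Definition link_rate (a : R) (b : bool) (p : nat) : R :=
  if b then if (p < K - sigma)%N then alpha * K%:R + a
            else if (p < K)%N then alpha * K%:R else 0
  else p%:R.

Definition link_gen (a : R) (v : nat -> R) (p : nat) : R :=
  \sum_b link_rate a b p * (v (link_move b p) - v p).

(** The bracket bounds the total rate of one link in one copy; the factor 2 makes the same constant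
    valid for a coupled pair of links. *)
Definition rate_bound : R := 2 * (3 * (alpha * K%:R) + K%:R).

Lemma alphaK_ge0 : 0 <= alpha * K%:R.
Proof. by rewrite mulr_ge0 ?ler0n// ltW. Qed.

Lemma link_rate_ge0 a b p : 0 <= a -> 0 <= link_rate a b p.
Proof.
move=> a0; rewrite /link_rate; case: b => //.
by case: ifP => _; rewrite ?addr_ge0 ?alphaK_ge0//; case: ifP => _; rewrite ?alphaK_ge0.
Qed.

Lemma link_rates_le a p : a <= 2 * (alpha * K%:R) -> (p <= K)%N ->
  link_rate a true p + link_rate a false p <= 3 * (alpha * K%:R) + K%:R.
Proof.
move=> a2 pK; have aK := alphaK_ge0.
apply: lerD; last by rewrite /link_rate ler_nat.
rewrite /link_rate; case: ifP => _; first lra.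
case: ifP => _; lra.
Qed.

Lemma link_move_le b p : (p <= K)%N -> (link_move b p <= K)%N.
Proof.
by move=> pK; case: b => /=; [exact: geq_minl | exact: leq_trans (leq_pred _) pK].
Qed.

Section State.
Variable n : nat.
Implicit Types (x y : state K n) (j : 'I_n).

Definition move (b : bool) (j : 'I_n) (x : state K n) : state K n :=
  [ffun i => if i == j then inord (link_move b (x j)) else x i].

Lemma ord_leK x j : (x j <= K)%N.
Proof. by rewrite -ltnS; exact: ltn_ord. Qed.

Lemma moveE b j x i :
  move b j x i = (if i == j then link_move b (x j) else x i) :> nat.
Proof.
rewrite ffunE; case: eqP => // _; rewrite inordK// ltnS.
exact/link_move_le/ord_leK.
Qed.

Definition extra x : R :=
  2 * (alpha * K%:R) * (full_prop R x * (1 - reserved_prop R sigma x)).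

Lemma prop_itv (P : pred 'I_n) : 0 <= (#|P|%:R / n%:R : R) <= 1.
Proof.
rewrite divr_ge0 ?ler0n//=; case: (posnP n) => [n0|n0].
  by have -> : n%:R = 0 :> R; [rewrite n0 | rewrite invr0 mulr0].
rewrite ler_pdivrMr ?ltr0n// mul1r ler_nat.
by apply: leq_trans (max_card _) _; rewrite card_ord.
Qed.

Lemma extra_itv x : 0 <= extra x <= 2 * (alpha * K%:R).
Proof.
have f01 : 0 <= full_prop R x <= 1 := prop_itv _.
have g01 : 0 <= reserved_prop R sigma x <= 1 := prop_itv _.
move: f01 g01; rewrite /extra.
move: (full_prop R x) (reserved_prop R sigma x) => f g.
move=> /andP[f0 f1] /andP[g0 g1]; have aK := alphaK_ge0.
apply/andP; split.
  by apply: mulr_ge0; [rewrite mulr_ge0 | apply: mulr_ge0 => //; lra].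
apply: ler_piMr; first by rewrite mulr_ge0.
have H : f * (1 - g) <= 1 * (1 - g) by rewrite ler_wpM2r// subr_ge0.
by apply: le_trans H _; lra.
Qed.

Lemma up_rateE x j : up_rate alpha sigma x j = link_rate (extra x) true (x j).
Proof.
by rewrite /up_rate /link_rate /extra; case: ifP => // _; ring.
Qed.

Definition net_gen : (state K n -> R) -> state K n -> R :=
  jump (fun (e : 'I_n * bool) x => link_rate (extra x) e.2 (x e.1))
       (fun e x => move e.2 e.1 x).

Lemma net_genE u x : net_gen u x =
  \sum_j \sum_b link_rate (extra x) b (x j) * (u (move b j x) - u x).
Proof. by rewrite /net_gen /jump pair_bigA. Qed.

Lemma net_gen_markov : markov_gen net_gen (n%:R * rate_bound).
Proof.
have rb0 : 0 <= rate_bound.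
  by rewrite /rate_bound mulr_ge0// addr_ge0 ?ler0n// mulr_ge0 ?alphaK_ge0.
apply: jump_markov; first by rewrite mulr_ge0.
- by move=> e x; apply: link_rate_ge0; have /andP[] := extra_itv x.
- move=> x; rewrite -(pair_bigA _ (fun j b => link_rate (extra x) b (x j))) /=.
  rewrite mulr_natl -[X in _ *+ X]card_ord -sumr_const.
  apply: ler_sum => j _; rewrite big_bool /=.
  have /andP[e0 e1] := extra_itv x.
  apply: le_trans (link_rates_le e1 (ord_leK x j)) _.
  move: rb0; rewrite /rate_bound; lra.
Qed.

Lemma qgen_dar : qgen (dar_rate alpha sigma K n) = net_gen.
Proof.
apply/funext => u; apply/funext => x; rewrite net_genE /qgen /dar_rate.
under eq_bigr do rewrite mulr_suml.
rewrite (exchange_big_dep predT)//=; apply: eq_bigr => j _.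
(* States agreeing with [x] off [j] are parametrized by their value [k] at [j]; only the two
   neighbours of [x j] have a nonzero rate. *)
pose h (k : 'I_K.+1) : state K n := [ffun i => if i == j then k else x i].
have hj k : h k j = k by rewrite ffunE eqxx.
rewrite (reindex_onto h (fun z : state K n => z j)) /=; last first.
  move=> z /forallP zx; apply/ffunP => i; rewrite ffunE.
  case: eqP => [->//|/eqP ij]; have := zx i; rewrite ij => /eqP->//.
rewrite (eq_bigl predT); last first.
  move=> k; rewrite hj eqxx andbT; apply/forallP => i.
  by apply/implyP => ij; rewrite ffunE (negbTE ij).
rewrite (eq_bigr (fun k : 'I_K.+1 =>
    (if k == (x j).+1 :> nat then up_rate alpha sigma x j * (u (h k) - u x) else 0)
    + (if k.+1 == x j :> nat then (x j)%:R * (u (h k) - u x) else 0))); last first.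
  move=> k _; rewrite hj; case: eqP => [->|_].
    by rewrite gtn_eqF ?addr0// ltnW.
  by case: eqP => _; rewrite add0r ?mul0r.
rewrite big_split /= big_bool /=.
have hm b : (link_move b (x j) <= K)%N -> h (inord (link_move b (x j))) = move b j x.
  by move=> _; apply/ffunP => i; rewrite !ffunE.
congr (_ + _).
  rewrite -big_mkcond /= up_rateE.
  have [xK|Kx] := ltnP (x j) K.
    rewrite (big_pred1 (inord (link_move true (x j)))); last first.
      move=> k /=; rewrite -[in RHS]val_eqE /= inordK /= ?(minn_idPr xK)//.
    by rewrite -(hm true) ?link_move_le ?ord_leK// /link_rate xK.
  rewrite big_pred0; last first.
    by move=> k; rewrite ltn_eqF// (leq_trans (ltn_ord k)).
  have -> : (x j < K - sigma)%N = false.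
    by apply/negbTE; rewrite -leqNgt leq_subLR (leq_trans Kx) ?leq_addl.
  by rewrite mul0r.
rewrite -big_mkcond /=.
case: (posnP (x j)) => [x0|x0].
  by rewrite big_pred0 ?x0 ?mul0r// => k; rewrite x0.
rewrite (big_pred1 (inord (link_move false (x j)))); last first.
  move=> k /=; rewrite -[in RHS]val_eqE /= inordK /=.
    by rewrite -[X in _ == X]prednK.
  by rewrite ltnS (leq_trans (leq_pred _))// ord_leK.
by rewrite -(hm false) ?link_move_le ?ord_leK.
Qed.

Lemma sum_move (V : zmodType) (F : 'I_n -> nat -> V) b j x :
  \sum_i F i (move b j x i) - \sum_i F i (x i) =
    F j (link_move b (x j)) - F j (x j).
Proof.
rewrite (bigD1 j)//= moveE eqxx [X in _ - X](bigD1 j)//= opprD addrACA.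
rewrite -[RHS]addr0; congr (_ + _); apply/eqP; rewrite subr_eq0; apply/eqP.
by apply: eq_bigr => i /negbTE ij; rewrite moveE ij.
Qed.

Lemma net_gen_sum (v : nat -> R) x :
  net_gen (fun x => \sum_i v (x i)) x = \sum_j link_gen (extra x) v (x j).
Proof.
rewrite net_genE; apply: eq_bigr => j _; apply: eq_bigr => b _.
by rewrite (sum_move (fun=> v)).
Qed.

(* In each coordinate both copies jump together at the smaller of their two
   rates, and the excess rate is used by one of them alone. *)
Definition cpl_rate (r1 r2 : R) (o : bool * bool) : R :=
  (if o.1 then if o.2 then Num.min r1 r2 else r1 - Num.min r1 r2
   else if o.2 then r2 - Num.min r1 r2 else 0).

Definition cpl_gen : (state K n * state K n -> R) -> state K n * state K n -> R :=
  jump (fun (e : 'I_n * bool * (bool * bool)) z =>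
          cpl_rate (link_rate (extra z.1) e.1.2 (z.1 e.1.1))
                   (link_rate (extra z.2) e.1.2 (z.2 e.1.1)) e.2)
       (fun e z => (if e.2.1 then move e.1.2 e.1.1 z.1 else z.1,
                    if e.2.2 then move e.1.2 e.1.1 z.2 else z.2)).

Lemma cpl_genE F x y : cpl_gen F (x, y) =
  \sum_j \sum_b \sum_(o : bool * bool)
    cpl_rate (link_rate (extra x) b (x j)) (link_rate (extra y) b (y j)) o *
    (F (if o.1 then move b j x else x, if o.2 then move b j y else y) - F (x, y)).
Proof. by rewrite /cpl_gen /jump [RHS]pair_bigA /= [RHS]pair_bigA. Qed.

Lemma cpl_rate_ge0 r1 r2 o : 0 <= r1 -> 0 <= r2 -> 0 <= cpl_rate r1 r2 o.
Proof.
move=> r10 r20; case: o => [[] []] //=.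
- by rewrite /cpl_rate /= le_min r10.
- by rewrite /cpl_rate /= subr_ge0 ge_min lexx.
- by rewrite /cpl_rate /= subr_ge0 ge_min lexx orbT.
Qed.

Lemma sum_bool2 (f : bool * bool -> R) : \sum_o f o =
  f (true, true) + f (true, false) + (f (false, true) + f (false, false)).
Proof.
transitivity (\sum_a \sum_b f (a, b)); last by rewrite !sum_bool.
by rewrite pair_bigA; apply: eq_bigr => -[].
Qed.

Lemma cpl_gen_markov : markov_gen cpl_gen (n%:R * rate_bound).
Proof.
have aK := alphaK_ge0.
have rb0 : 0 <= rate_bound by rewrite /rate_bound mulr_ge0// addr_ge0 ?ler0n// mulr_ge0.
apply: jump_markov; first by rewrite mulr_ge0.
- move=> e z; apply: cpl_rate_ge0; apply: link_rate_ge0.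
    by have /andP[] := extra_itv z.1.
  by have /andP[] := extra_itv z.2.
- move=> [x y] /=.
  rewrite -(pair_bigA _ (fun e o => cpl_rate (link_rate (extra x) e.2 (x e.1))
     (link_rate (extra y) e.2 (y e.1)) o)) /=.
  rewrite -(pair_bigA _ (fun j b => \sum_o cpl_rate (link_rate (extra x) b (x j))
     (link_rate (extra y) b (y j)) o)) /=.
  rewrite mulr_natl -[X in _ *+ X]card_ord -sumr_const.
  apply: ler_sum => j _.
  have le r1 r2 : 0 <= r1 -> 0 <= r2 -> \sum_o cpl_rate r1 r2 o <= r1 + r2.
    move=> r10 r20; rewrite sum_bool2 /cpl_rate /=.
    have : 0 <= Num.min r1 r2 by rewrite le_min r10.
    lra.
  have /andP[e0 e1] := extra_itv x; have /andP[e2 e3] := extra_itv y.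
  rewrite big_bool.
  apply: le_trans (lerD (le _ _ (link_rate_ge0 _ _ e0) (link_rate_ge0 _ _ e2))
                        (le _ _ (link_rate_ge0 _ _ e0) (link_rate_ge0 _ _ e2))) _.
  have -> : rate_bound = 3 * (alpha * K%:R) + K%:R + (3 * (alpha * K%:R) + K%:R).
    by rewrite /rate_bound; ring.
  rewrite addrACA.
  by apply: lerD; apply: link_rates_le => //; exact: ord_leK.
Qed.

(** The outcomes in which the first copy moves have rates adding up to its own rate, so each
    marginal of the coupling is the network itself. *)
Lemma cpl_gen_fst u : cpl_gen (fun z => u z.1) = fun z => net_gen u z.1.
Proof.
apply/funext => -[x y]; rewrite cpl_genE net_genE /=.
apply: eq_bigr => j _; apply: eq_bigr => b _.
by rewrite sum_bool2 /cpl_rate /=; ring.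
Qed.

Lemma cpl_gen_snd u : cpl_gen (fun z => u z.2) = fun z => net_gen u z.2.
Proof.
apply/funext => -[x y]; rewrite cpl_genE net_genE /=.
apply: eq_bigr => j _; apply: eq_bigr => b _.
by rewrite sum_bool2 /cpl_rate /=; ring.
Qed.

Lemma semi_cpl_fst u t x y :
  semi cpl_gen t (fun z => u z.1) (x, y) = semi net_gen t u x.
Proof.
rewrite /semi; congr egf; apply/funext => k.
have -> : iter k cpl_gen (fun z => u z.1) = fun z => iter k net_gen u z.1.
  by elim: k => [//|k IH]; rewrite !iterS IH cpl_gen_fst.
by [].
Qed.

Lemma semi_cpl_snd u t x y :
  semi cpl_gen t (fun z => u z.2) (x, y) = semi net_gen t u y.
Proof.
rewrite /semi; congr egf; apply/funext => k.
have -> : iter k cpl_gen (fun z => u z.2) = fun z => iter k net_gen u z.2.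
  by elim: k => [//|k IH]; rewrite !iterS IH cpl_gen_snd.
by [].
Qed.

(** Generator of one coupled pair of links with the two extra rates frozen: the links interact only
    through these numbers. *)
Definition cpl_link (a1 a2 : R) (phi : nat -> nat -> R) (p q : nat) : R :=
  \sum_b \sum_(o : bool * bool)
    cpl_rate (link_rate a1 b p) (link_rate a2 b q) o *
    (phi (if o.1 then link_move b p else p) (if o.2 then link_move b q else q)
     - phi p q).

Lemma cpl_gen_sum (phi : nat -> nat -> R) x y :
  cpl_gen (fun z => \sum_i phi (z.1 i) (z.2 i)) (x, y) =
    \sum_j cpl_link (extra x) (extra y) phi (x j) (y j).
Proof.
rewrite cpl_genE; apply: eq_bigr => j _; apply: eq_bigr => b _.
apply: eq_bigr => o _; congr (_ * _) => /=.
rewrite (bigD1 j)//= [X in _ - X](bigD1 j)//= opprD addrACA.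
have e (c : bool) z i : (if c then move b j z else z) i =
    (if c && (i == j) then link_move b (z j) else z i) :> nat.
  by case: c => //=; rewrite moveE.
rewrite !e !eqxx !andbT -[RHS]addr0; congr (_ + _).
apply/eqP; rewrite subr_eq0; apply/eqP.
by apply: eq_bigr => i /negbTE ij; rewrite !e ij !andbF.
Qed.

End State.
End Network.

(** * Lyapunov function *)

Section Lyapunov.
Variables (R : realType) (alpha : R) (sigma K : nat).
Hypothesis alpha_gt0 : 0 < alpha.
Variables (v : nat -> R) (vm k1 c1 : R).
Hypothesis v_itv : forall p, (p <= K)%N -> 0 <= v p <= vm.
Hypothesis k1_gt0 : 0 < k1.
Hypothesis c1_gt0 : 0 < c1.
Hypothesis v_drift : forall a p, 0 <= a -> a <= 2 * (alpha * K%:R) ->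
  (p <= K)%N -> link_gen alpha sigma K a v p <= k1 * (c1 - v p).

(** For small [theta] the second-order part of the exponential increments costs at most another
    [k1 * c1] per link, so with [S] the sum of the [v (x i)] the drift is at most
    [theta * k1 * (2 * c1 * n - S)] times the exponential. [theta] does not depend on [n]. *)
Lemma exp_lyapunov : exists2 theta : R, 0 < theta & forall (n : nat) (x : state K n),
  0 < n%:R :> R ->
  net_gen alpha sigma (fun x => expR (theta * \sum_i v (x i))) x <=
    - (theta * k1 * c1 * n%:R) * expR (theta * \sum_i v (x i)) +
    3 * (theta * k1 * c1 * n%:R) * expR (3 * theta * c1 * n%:R).
Proof.
have vm0 : 0 <= vm by have /andP[] := v_itv (leq0n K); exact: le_trans.
have aK : 0 <= alpha * K%:R by exact: alphaK_ge0.
have rb0 : 0 <= rate_bound alpha K.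
  by rewrite /rate_bound mulr_ge0// addr_ge0 ?ler0n// mulr_ge0.
set rb := rate_bound alpha K in rb0 *.
pose den := 2 * vm + rb * vm ^+ 2 + 1.
have den1 : 0 < den.
  by rewrite /den ltr_wpDl// addr_ge0// mulr_ge0// sqr_ge0.
have [theta [th0 thd thd2]] : exists theta : R,
    [/\ 0 < theta, theta * den <= 1 & theta * den <= k1 * c1].
  (* [den] collects what is required: [theta * vm <= 1 / 2] for the quadratic bound on the
     exponential, and [theta * (rb * vm ^+ 2) <= k1 * c1] for the second-order terms. *)
  exists (Num.min 1 (k1 * c1) / den).
  rewrite !mulfVK ?gt_eqF// !ge_min !lexx orbT divr_gt0//.
  by rewrite lt_min ltr01 mulr_gt0.
have s1 : 0 <= theta * (2 * vm) by rewrite (mulr_ge0 (ltW th0))// mulr_ge0.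
have s2 : 0 <= theta * (rb * vm ^+ 2) by rewrite (mulr_ge0 (ltW th0))// mulr_ge0// sqr_ge0.
have thE : theta * den = theta * (2 * vm) + theta * (rb * vm ^+ 2) + theta.
  by rewrite /den; ring.
have th_vm : theta * vm <= 1 / 2.
  have : theta * (2 * vm) = 2 * (theta * vm) by ring.
  lra.
have th_rb : theta * (rb * vm ^+ 2) <= k1 * c1 by lra.
exists theta => // n x n0.
rewrite net_genE.
set V := expR (theta * \sum_i v (x i)).
have V0 : 0 < V by exact: expR_gt0.
have /andP[e0 e1] := extra_itv sigma alpha_gt0 x.
have bound j : \sum_b link_rate alpha sigma K (extra alpha sigma x) b (x j) *
    (expR (theta * \sum_i v (move b j x i)) - V) <=
    V * (theta * k1 * (2 * c1 - v (x j))).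
  have pK := ord_leK x j.
  have E b : expR (theta * \sum_i v (move b j x i)) - V =
      V * (expR (theta * (v (link_move K b (x j)) - v (x j))) - 1).
    rewrite mulrBr mulr1 -expRD; congr (expR _ - _).
    by rewrite -(sum_move (fun=> v)); ring.
  have le b : expR (theta * (v (link_move K b (x j)) - v (x j))) - 1 <=
      theta * (v (link_move K b (x j)) - v (x j)) + 2 * theta ^+ 2 * vm ^+ 2.
    set w := v _ - v _.
    have wn : `|w| <= vm.
      have /andP[p0 p1] := v_itv pK.
      have /andP[q0 q1] := v_itv (link_move_le b pK).
      by rewrite /w ler_norml; apply/andP; split; lra.
    have zn : `|theta * w| <= 1 / 2.
      rewrite normrM (gtr0_norm th0); apply: le_trans th_vm.
      by rewrite ler_wpM2l// ltW.
    apply: le_trans (expR_quad zn) _; rewrite lerD2l exprMn -mulrA.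
    rewrite ler_wpM2l// ler_wpM2l ?sqr_ge0//.
    by rewrite -(real_normK (num_real w)) lerXn2r// nnegrE.
  apply: (@le_trans _ _ (V * \sum_b link_rate alpha sigma K (extra alpha sigma x) b (x j) *
     (theta * (v (link_move K b (x j)) - v (x j)) + 2 * theta ^+ 2 * vm ^+ 2))).
    rewrite mulr_sumr; apply: ler_sum => b _.
    rewrite E mulrCA ler_pM2l// ler_wpM2l//.
    exact: link_rate_ge0.
  rewrite ler_pM2l//.
  have -> : \sum_b link_rate alpha sigma K (extra alpha sigma x) b (x j) *
     (theta * (v (link_move K b (x j)) - v (x j)) + 2 * theta ^+ 2 * vm ^+ 2) =
     theta * link_gen alpha sigma K (extra alpha sigma x) v (x j) +
     theta * (theta * (2 * (link_rate alpha sigma K (extra alpha sigma x) true (x j) +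
      link_rate alpha sigma K (extra alpha sigma x) false (x j)) * vm ^+ 2)).
    by rewrite /link_gen !sum_bool; ring.
  have H1 := v_drift e0 e1 pK.
  have H2 := link_rates_le sigma alpha_gt0 e1 pK.
  have -> : theta * k1 * (2 * c1 - v (x j)) =
    theta * (k1 * (c1 - v (x j))) + theta * (k1 * c1) by ring.
  apply: lerD; rewrite ler_pM2l//.
  apply: le_trans th_rb; rewrite ler_pM2l// ler_wpM2r ?sqr_ge0//.
  by rewrite /rb /rate_bound ler_pM2l.
apply: (@le_trans _ _ (V * (theta * k1 * (2 * c1 * n%:R - \sum_i v (x i))))).
  apply: le_trans (ler_sum _ (fun j _ => bound j)) _.
  rewrite -mulr_sumr -mulr_sumr sumrB sumr_const card_ord.
  by rewrite -[_ *+ n]mulr_natr.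
set S := \sum_i v (x i) in V V0 bound *.
have tk : 0 < theta * k1 by rewrite mulr_gt0.
have c1n : 0 < c1 * n%:R by rewrite mulr_gt0.
(* Above [3 * c1 * n] the drift is negative enough by itself; below it, [V] is at most the
   exponential appearing in the additive term. *)
have [hS|hS] := lerP (3 * c1 * n%:R) S.
  have : 0 <= 3 * (theta * k1 * c1 * n%:R) * expR (3 * theta * c1 * n%:R).
    by rewrite !mulr_ge0 ?expR_ge0// ltW.
  have : V * (theta * k1) * (2 * c1 * n%:R - S) <= V * (theta * k1) * (- (c1 * n%:R)).
    by rewrite ler_pM2l ?mulr_gt0//; lra.
  have -> : V * (theta * k1) * (- (c1 * n%:R)) = - (theta * k1 * c1 * n%:R) * V.
    by ring.
  by rewrite -!mulrA; lra.
have VS : V <= expR (3 * theta * c1 * n%:R).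
  rewrite ler_expR; have -> : 3 * theta * c1 * n%:R = theta * (3 * c1 * n%:R) by ring.
  by rewrite ler_pM2l// ltW.
have S0 : 0 <= S.
  by apply: sumr_ge0 => i _; have /andP[] := v_itv (ord_leK x i).
have H1 : V * (theta * k1) * (2 * c1 * n%:R - S) <= V * (theta * k1) * (2 * (c1 * n%:R)).
  by rewrite ler_pM2l ?mulr_gt0//; lra.
have H2 : 3 * (theta * k1 * c1 * n%:R) * V <=
    3 * (theta * k1 * c1 * n%:R) * expR (3 * theta * c1 * n%:R).
  by rewrite ler_wpM2l// !mulr_ge0// ltW.
have E1 : V * (theta * k1) * (2 * (c1 * n%:R)) =
   - (theta * k1 * c1 * n%:R) * V + 3 * (theta * k1 * c1 * n%:R) * V by ring.
rewrite mulrA; lra.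
Qed.

(** Gronwall bounds the exponential moment by [4 * expR (3 * theta * c1 * n)], and Markov's
    inequality at level [4 * c1 * n] leaves the factor [expR (- (theta * c1 * n))]. *)
Lemma bad_prob : exists2 theta : R, 0 < theta & forall (n : nat) (x : state K n) t,
  0 < n%:R :> R -> vm / (k1 * c1) <= t ->
  semi (@net_gen R alpha sigma K n) t (fun x => (4 * c1 * n%:R < \sum_i v (x i))%R%:R) x
    <= 4 * expR (- (theta * c1 * n%:R)).
Proof.
have [theta th0 H] := exp_lyapunov; exists theta => // n x t n0 tT.
have vm0 : 0 <= vm by have /andP[] := v_itv (leq0n K); exact: le_trans.
have kc : 0 < k1 * c1 by rewrite mulr_gt0.
have t0 : 0 <= t by apply: le_trans tT; rewrite divr_ge0// ltW.
have G := net_gen_markov sigma K alpha_gt0 n.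
set V : state K n -> R := fun x => expR (theta * \sum_i v (x i)).
have lam0 : 0 < theta * k1 * c1 * n%:R by rewrite !mulr_gt0.
have EV : semi (@net_gen R alpha sigma K n) t V x <= 4 * expR (3 * theta * c1 * n%:R).
  have eta0 : 0 <= 3 * (theta * k1 * c1 * n%:R) * expR (3 * theta * c1 * n%:R).
    by rewrite !mulr_ge0 ?expR_ge0// ltW.
  have := fsemi_gronwall G (x := x) lam0 eta0 (lexx 0) (fun z => H n z n0) _ t0.
  move=> /(_ _); rewrite subr0 semi0 => H'.
  apply: le_trans (H' _) _.
    by move=> s s0; rewrite (semi_cst G).
  have cancel (k E : R) : 0 < k -> 3 * k * E / k = 3 * E.
    by move=> kp; field; rewrite gt_eqF.
  rewrite cancel//.
  (* The burn-in time [vm / (k1 * c1)] is the time in which decay at rate [theta * k1 * c1 * n]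
     absorbs the worst initial value [expR (theta * (n * vm))]. *)
  suff : expR (- (theta * k1 * c1 * n%:R) * t) * V x <= 1.
    have : 1 <= expR (3 * theta * c1 * n%:R).
      by rewrite -[X in X <= _]expR0 ler_expR !mulr_ge0// ltW.
    rewrite -/(V x); lra.
  rewrite /V -expRD -[X in _ <= X]expR0 ler_expR mulNr addrC subr_le0.
  apply: (@le_trans _ _ (theta * (n%:R * vm))).
    rewrite ler_pM2l// mulr_natl -[X in _ *+ X]card_ord -sumr_const.
    by apply: ler_sum => i _; have /andP[] := v_itv (ord_leK x i).
  have -> : theta * k1 * c1 * n%:R * t = theta * (n%:R * (k1 * c1 * t)) by ring.
  by rewrite ler_pM2l// ler_pM2l// mulrC -ler_pdivrMr.
have le1 (z : state K n) : (4 * c1 * n%:R < \sum_i v (z i))%R%:R <=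
    expR (- (4 * theta * c1 * n%:R)) * V z.
  case: ltP => h /=; last by rewrite mulr_ge0 ?expR_ge0.
  rewrite /V -expRD -[X in X <= _]expR0 ler_expR.
  have : theta * (4 * c1 * n%:R) <= theta * \sum_i v (z i).
    by rewrite ler_pM2l// ltW.
  have : theta * (4 * c1 * n%:R) = 4 * theta * c1 * n%:R by ring.
  lra.
apply: le_trans (fsemi_mono G x t0 le1) _; rewrite (fsemiM G).
have -> : 4 * expR (- (theta * c1 * n%:R)) =
    expR (- (4 * theta * c1 * n%:R)) * (4 * expR (3 * theta * c1 * n%:R)).
  rewrite mulrCA -expRD; congr (_ * expR _); ring.
by rewrite ler_pM2l// expR_gt0.
Qed.

End Lyapunov.

(** * Contraction of the coupling *)

Section Contraction.
Variables (R : realType) (alpha : R) (sigma K : nat).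
Hypothesis alpha_gt0 : 0 < alpha.
Hypothesis sigma_lt : (sigma < K)%N.
Variables (w : nat -> R) (lam : R).
Hypothesis lam_le1 : lam <= 1.

Let h i := w i.+1 - w i.
Let m := (K - sigma)%N.

Hypothesis h_ge1 : forall i, 1 <= h i.
Hypothesis h_mono : forall i, h i <= h i.+1.

(** Away from the thresholds this says exactly that the drift of [w] at extra rate [a] decreases by
    at least [lam * h i] from [i] to [i.+1]. *)
Definition contractive (a : R) := forall i, (i.+1 < K)%N ->
  (alpha * K%:R + (if (i.+1 < m)%N then a else 0)) * (h i.+1 - h i) <=
    i%:R * (h i - h i.-1) + (1 - lam) * h i.

Let m_gt0 : (0 < m)%N. Proof. by rewrite subn_gt0. Qed.
Let m_leK : (m <= K)%N. Proof. exact: leq_subr. Qed.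
Let h_ge0 i : 0 <= h i. Proof. exact: le_trans (h_ge1 i). Qed.

Lemma weight_mono p q : (p <= q)%N -> w p <= w q.
Proof.
move=> /subnK <-; elim: (q - p)%N => // k IH; apply: le_trans IH _.
by rewrite addSn -subr_ge0; exact: h_ge0.
Qed.

Lemma slope_mono p q : (p <= q)%N -> h p <= h q.
Proof.
move=> /subnK <-; elim: (q - p)%N => // k IH; apply: le_trans IH _.
by rewrite addSn; exact: h_mono.
Qed.

Let G a p := link_rate alpha sigma K a true p * h p - p%:R * h p.-1.

Lemma link_gen_weight a p : (p <= K)%N -> link_gen alpha sigma K a w p = G a p.
Proof.
move=> pK; rewrite /link_gen sum_bool /G; congr (_ + _).
  have [pK'|Kp] := ltnP p K; first by rewrite /link_move (minn_idPr pK').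
  have -> : p = K by apply/eqP; rewrite eqn_leq pK.
  by rewrite /link_rate -/m ltnNge m_leK /= ltnn !mul0r.
rewrite /link_rate /link_move; case: p pK => [|p] pK; first by rewrite !mul0r oppr0.
by rewrite /h -mulrN opprB.
Qed.

(** A step into [m] also loses the extra rate [a], and a step into [K] loses the arrival rate
    [alpha * K]; these losses are the two additional negative terms. *)
Lemma weight_step a i : contractive a -> (i < K)%N ->
  G a i.+1 - G a i <= - lam * h i - a * h m.-1 *+ (i.+1 == m)
    - alpha * K%:R * h K.-1 *+ (i.+1 == K).
Proof.
move=> Ha iK; rewrite /G /link_rate -/m.
have hm : i%:R * h i.-1 <= i%:R * h i by rewrite ler_wpM2l// slope_mono// leq_pred.
have hl : lam * h i <= 1 * h i by rewrite ler_wpM2r.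
rewrite -[in X in X * h i.+1.-1]natr1 /= mulrDl mul1r.
have [iK'|Ki] := ltnP i.+1 K.
  rewrite (ltn_eqF iK') mulr0n subr0 iK.
  have := Ha i iK'.
  have [im|mi|im] := ltngtP i.+1 m.
  - rewrite mulr0n subr0; lra.
  - rewrite mulr0n subr0; lra.
  - rewrite -im mulr1n /=; lra.
have iE : i.+1 = K by apply/eqP; rewrite eqn_leq iK.
have -> : (i.+1 == K) = true by apply/eqP.
have -> : K.-1 = i by rewrite -iE.
rewrite iK mulr1n.
have [im|mi|im] := ltngtP i.+1 m.
- by move: m_leK; rewrite -iE leqNgt im.
- rewrite mulr0n subr0; lra.
- rewrite -im mulr1n /=; lra.
Qed.

(** Sum of the unit steps from [q] to [p]; each threshold is crossed at most once, and is crossed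
    exactly when it separates [p] from [q]. *)
Lemma weight_drift a p q : 0 <= a -> contractive a -> (q < p)%N -> (p <= K)%N ->
  G a p - G a q <= - lam * (w p - w q)
    - a * h m.-1 * ((p < m) != (q < m))%N%:R
    - alpha * K%:R * h K.-1 * ((p == K) != (q == K))%:R.
Proof.
move=> a0 Ha.
have aK := alphaK_ge0 K alpha_gt0.
elim: p => // p IH; rewrite ltnS leq_eqVlt => /predU1P[->|qp] pK.
  apply: le_trans (weight_step Ha pK) _.
  have -> : w p.+1 - w p = h p by [].
  rewrite -[_ *+ (_ == m)]mulr_natr -[_ *+ (_ == K)]mulr_natr (ltn_eqF pK).
  apply: lerB; last by case: (p.+1 == K).
  rewrite lerD2l lerN2 ler_wpM2l ?mulr_ge0// ler_nat.
  by case: eqP; case: ltnP; case: ltnP => //=; lia.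
have {}IH := IH qp (ltnW pK); have S := weight_step Ha pK.
have h1 : 0 <= a * h m.-1 by rewrite mulr_ge0.
have h2 : 0 <= alpha * K%:R * h K.-1 by rewrite mulr_ge0.
have S1 : a * h m.-1 * ((p.+1 < m) != (q < m))%N%:R <=
    a * h m.-1 * ((p < m) != (q < m))%N%:R + a * h m.-1 *+ (p.+1 == m).
  rewrite -[_ *+ (_ == m)]mulr_natr -mulrDr ler_wpM2l// -natrD ler_nat.
  by case: eqP; case: ltnP; case: ltnP; case: ltnP => //=; lia.
have S2 : alpha * K%:R * h K.-1 * ((p.+1 == K) != (q == K))%:R <=
    alpha * K%:R * h K.-1 * ((p == K) != (q == K))%:R
    + alpha * K%:R * h K.-1 *+ (p.+1 == K).
  rewrite -[_ *+ (_ == K)]mulr_natr -mulrDr ler_wpM2l// -natrD ler_nat.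
  by case: eqP; case: eqP; case: eqP => //= *; lia.
move: IH S S1 S2; have -> : h p = w p.+1 - w p by []; lra.
Qed.

Definition weight_dist p q : R := `|w p - w q|.

Lemma weight_distC p q : weight_dist p q = weight_dist q p.
Proof. exact: distrC. Qed.

Lemma weight_distE p q : (q <= p)%N -> weight_dist p q = w p - w q.
Proof. by move=> /weight_mono qp; rewrite /weight_dist ger0_norm// subr_ge0. Qed.

Lemma cpl_linkC a1 a2 p q :
  cpl_link alpha sigma K a1 a2 weight_dist p q =
  cpl_link alpha sigma K a2 a1 weight_dist q p.
Proof.
rewrite /cpl_link; apply: eq_bigr => b _; rewrite !sum_bool2 /cpl_rate /=.
rewrite [in RHS]minC (weight_distC (link_move K b q) (link_move K b p)).
rewrite (weight_distC (link_move K b q) p) (weight_distC q (link_move K b p)).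
by rewrite (weight_distC q p); ring.
Qed.

(** Joint moves keep the order and a move of one copy alone closes at most the gap of one, so the
    links never overtake each other. The absolute value then opens with a fixed sign and only the
    marginal drifts remain. *)
Lemma cpl_link_gt a1 a2 p q : (q < p)%N -> (p <= K)%N ->
  cpl_link alpha sigma K a1 a2 weight_dist p q =
    link_gen alpha sigma K a1 w p - link_gen alpha sigma K a2 w q.
Proof.
move=> qp pK.
have W b : [/\ (link_move K b q <= link_move K b p)%N, (link_move K b q <= p)%N
  & (q <= link_move K b p)%N].
  by case: b => /=; rewrite /minn; split; repeat case: ifP; lia.
rewrite /cpl_link /link_gen -sumrB; apply: eq_bigr => b _.
have [W1 W2 W3] := W b.
rewrite sum_bool2 /cpl_rate /= !weight_distE//; last exact: ltnW.
by ring.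
Qed.

(** Equal links separate only through the excess [a1 - a2], which acts below [m], where the slope is
    at most [h m.-1]. *)
Lemma cpl_link_eq a1 a2 p : a2 <= a1 -> (p <= K)%N ->
  cpl_link alpha sigma K a1 a2 weight_dist p p <=
    (a1 - a2) * h m.-1 * (p < m)%N%:R.
Proof.
move=> a12 pK; rewrite /cpl_link.
have E b r1 r2 : \sum_(o : bool * bool) cpl_rate r1 r2 o *
    (weight_dist (if o.1 then link_move K b p else p)
       (if o.2 then link_move K b p else p) - weight_dist p p) =
    (r1 - Num.min r1 r2 + (r2 - Num.min r1 r2)) * weight_dist (link_move K b p) p.
  rewrite sum_bool2 /cpl_rate /= [weight_dist p (link_move _ _ _)]weight_distC.
  rewrite /weight_dist !subrr normr0; ring.
rewrite sum_bool !E {E} [X in _ + X]/= minxx subrr addr0 mul0r addr0.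
rewrite /link_rate -/m; have [pm|mp] := ltnP p m.
  have -> : Num.min (alpha * K%:R + a1) (alpha * K%:R + a2) = alpha * K%:R + a2.
    by apply/min_idPr; rewrite lerD2l.
  rewrite subrr addr0 mulr1 /link_move (minn_idPr (leq_trans pm m_leK)).
  rewrite weight_distE//.
  have -> : alpha * K%:R + a1 - (alpha * K%:R + a2) = a1 - a2 by ring.
  rewrite ler_wpM2l ?subr_ge0//; apply: slope_mono.
  by rewrite -ltnS prednK.
by rewrite minxx subrr addr0 mul0r mulr0.
Qed.

(** Both drifts are compared at the larger rate [a1]. The correction is charged to the copy with the
    smaller rate, hence the factor [q < m]; when [p < q] the correction has the favourable sign. *)
Lemma cpl_link_le a1 a2 p q : 0 <= a1 -> a2 <= a1 -> contractive a1 ->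
  (p <= K)%N -> (q <= K)%N ->
  cpl_link alpha sigma K a1 a2 weight_dist p q <=
   - lam * weight_dist p q
    - a1 * h m.-1 * ((p < m) != (q < m))%N%:R
    - alpha * K%:R * h K.-1 * ((p == K) != (q == K))%:R
    + (a1 - a2) * h m.-1 * (q < m)%N%:R.
Proof.
move=> a0 a12 Ha pK qK.
have hd : 0 <= h m.-1 by [].
have GE : G a2 q = G a1 q - (a1 - a2) * h q * (q < m)%N%:R.
  by rewrite /G /link_rate -/m; case: ifP => _ /=; ring.
have hq : (a1 - a2) * h q * (q < m)%N%:R <= (a1 - a2) * h m.-1 * (q < m)%N%:R.
  have [qm|_] := ltnP q m; last by rewrite !mulr0.
  by rewrite !mulr1 ler_wpM2l ?subr_ge0// slope_mono// -ltnS prednK.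
have hq0 : 0 <= (a1 - a2) * h q * (q < m)%N%:R by rewrite !mulr_ge0// subr_ge0.
have [qp|pq|<-] := ltngtP q p.
- rewrite cpl_link_gt// !link_gen_weight// weight_distE; last exact: ltnW.
  have := weight_drift a0 Ha qp pK; rewrite GE; lra.
- rewrite cpl_linkC cpl_link_gt// !link_gen_weight// weight_distC weight_distE; last exact: ltnW.
  have := weight_drift a0 Ha pq qK; rewrite GE.
  rewrite (eq_sym (q < m)%N) (eq_sym (q == K)); lra.
- rewrite !eqxx !mulr0 !subr0 /weight_dist subrr normr0 mulr0 add0r.
  exact: cpl_link_eq.
Qed.

(** * From one coupled link to the whole network *)

Section State.
Variable n : nat.
Hypothesis n_gt0 : (0 < n)%N.

Definition state_dist (z : state K n * state K n) : R :=
  \sum_i weight_dist (z.1 i) (z.2 i).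

Let n0 : 0 < n%:R :> R. Proof. by rewrite ltr0n. Qed.

Lemma full_propE (x : state K n) : n%:R * full_prop R x = \sum_i (x i == K :> nat)%:R.
Proof.
rewrite /full_prop mulrC mulfVK ?gt_eqF// -sum1_card natr_sum big_mkcond /=.
by apply: eq_bigr => i _; rewrite inE; case: ifP.
Qed.

Lemma reserved_propE (x : state K n) :
  n%:R * (1 - reserved_prop R sigma x) = \sum_i (x i < m)%N%:R.
Proof.
have -> : \sum_i (x i < m)%N%:R = \sum_i (1 - (m <= x i)%N%:R) :> R.
  by apply: eq_bigr => i _; rewrite ltnNge; case: leqP => _; rewrite ?subr0 ?subrr.
rewrite sumrB sumr_const card_ord mulrBr mulr1; congr (_ - _).
rewrite /reserved_prop mulrC mulfVK ?gt_eqF// -sum1_card natr_sum big_mkcond /=.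
by apply: eq_bigr => i _; rewrite inE -/m; case: ifP.
Qed.

Definition good_state (x : state K n) :=
  contractive (extra alpha sigma x) /\
  2 * (1 - reserved_prop R sigma x) ^+ 2 * h m.-1 <= h K.-1.

(* f_x (1 - g_x) - f_y (1 - g_y) = (f_x - f_y) (1 - g_y) + f_x (g_y - g_x):
   the first part is paid for by the links that are full in exactly one copy,
   the second one by the links that are reserved in exactly one copy. *)
Lemma cpl_gen_dist_le x y : extra alpha sigma y <= extra alpha sigma x ->
  good_state x -> good_state y ->
  cpl_gen alpha sigma state_dist (x, y) <= - lam * state_dist (x, y).
Proof.
move=> axy [Hx _] [_ Hy]; rewrite cpl_gen_sum.
have /andP[ax0 _] := extra_itv sigma alpha_gt0 x.
have aK := alphaK_ge0 K alpha_gt0.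
apply: le_trans (ler_sum _ (fun j _ => cpl_link_le ax0 axy Hx (ord_leK x j) (ord_leK y j))) _.
rewrite !big_split /= !sumrN -!mulr_sumr -reserved_propE.
rewrite /state_dist /= -[X in _ <= X]addr0 -!addrA lerD2l.
set Ng := \sum_i _; set Nf := \sum_i _.
have HNf : n%:R * (full_prop R x - full_prop R y) <= Nf.
  rewrite mulrBr !full_propE -sumrB; apply: ler_sum => i _.
  by case: eqP; case: eqP => *; rewrite /= ?subr0 ?subrr ?sub0r//; lra.
have HNg : n%:R * (reserved_prop R sigma y - reserved_prop R sigma x) <= Ng.
  have -> : n%:R * (reserved_prop R sigma y - reserved_prop R sigma x) =
    n%:R * (1 - reserved_prop R sigma x) - n%:R * (1 - reserved_prop R sigma y) by ring.
  rewrite !reserved_propE -sumrB; apply: ler_sum => i _.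
  by case: ltnP => _; case: ltnP => _; rewrite /= ?subr0 ?subrr ?sub0r//; lra.
have Nf0 : 0 <= Nf by exact: sumr_ge0.
have Ng0 : 0 <= Ng by exact: sumr_ge0.
move: Hy HNf HNg; rewrite /extra.
have /andP[fx0 fx1] : 0 <= full_prop R x <= 1 := prop_itv _ _.
have /andP[_ gx1] : 0 <= reserved_prop R sigma x <= 1 := prop_itv _ _.
have /andP[gy0 gy1] : 0 <= reserved_prop R sigma y <= 1 := prop_itv _ _.
move: (h_ge0 m.-1) (h_ge0 K.-1) aK n0 fx0 gx1 gy1 Nf0 Ng0.
move: (full_prop R x) (full_prop R y) (reserved_prop R sigma x) (reserved_prop R sigma y)
  (h m.-1) (h K.-1) (alpha * K%:R) (n%:R : R) Nf Ng.
move=> fx fy gx gy h1 H aK N Nf Ng h10 H0 aK0 N0 fx0 gx1 gy1 Nf0 Ng0 Hy HNf HNg.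
have T1 : aK * (2 * (1 - gy) ^+ 2 * h1) * (N * (fx - fy)) <= aK * H * Nf.
  apply: (@le_trans _ _ (aK * (2 * (1 - gy) ^+ 2 * h1) * Nf)).
    by rewrite ler_wpM2l// !mulr_ge0// subr_ge0.
  by rewrite ler_wpM2r// ler_wpM2l.
(* If [gx <= gy] then [1 - gy <= 1 - gx], and [Ng] dominates the difference; otherwise the left side
   is nonpositive. *)
have T2 : 2 * aK * h1 * fx * (1 - gy) * (N * (gy - gx)) <=
    2 * aK * h1 * fx * (1 - gx) * Ng.
  have c0 : 0 <= 2 * aK * h1 * fx by rewrite !mulr_ge0.
  have [gxy|gyx] := lerP gx gy.
    apply: (@le_trans _ _ (2 * aK * h1 * fx * (1 - gy) * Ng)).
      by rewrite ler_wpM2l// mulr_ge0// subr_ge0.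
    by rewrite ler_wpM2r// ler_wpM2l//; lra.
  apply: (@le_trans _ _ 0).
    apply: mulr_ge0_le0; first by rewrite mulr_ge0// subr_ge0.
    by apply: mulr_ge0_le0; [exact: ltW | lra].
  by rewrite !mulr_ge0// subr_ge0; lra.
rewrite -subr_ge0.
apply: (@le_trans _ _ ((aK * H * Nf - aK * (2 * (1 - gy) ^+ 2 * h1) * (N * (fx - fy))) +
  (2 * aK * h1 * fx * (1 - gx) * Ng - 2 * aK * h1 * fx * (1 - gy) * (N * (gy - gx))))).
  by rewrite addr_ge0// subr_ge0.
rewrite le_eqVlt; apply/orP; left; apply/eqP; ring.
Qed.

Lemma cpl_gen_dist x y : good_state x -> good_state y ->
  cpl_gen alpha sigma state_dist (x, y) <= - lam * state_dist (x, y).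
Proof.
move=> gx gy; have [xy|/ltW yx] := lerP (extra alpha sigma y) (extra alpha sigma x).
  exact: cpl_gen_dist_le.
have dC : state_dist (x, y) = state_dist (y, x).
  by apply: eq_bigr => i _; exact: weight_distC.
rewrite dC; apply: le_trans (cpl_gen_dist_le yx gy gx).
by rewrite !cpl_gen_sum; apply: ler_sum => j _; rewrite cpl_linkC.
Qed.

Lemma state_dist_le z : 0 <= state_dist z <= n%:R * (w K - w 0%N).
Proof.
rewrite /state_dist sumr_ge0 => [|i _]; last exact: normr_ge0.
rewrite /= mulr_natl -[X in _ *+ X]card_ord -sumr_const; apply: ler_sum => i _.
have H (x : state K n) : w 0%N <= w (x i) <= w K.
  by rewrite !weight_mono// ord_leK.
have /andP[x0 x1] := H z.1; have /andP[y0 y1] := H z.2.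
by rewrite /weight_dist ler_norml; apply/andP; split; lra.
Qed.

(** Slopes at least 1 make the distance dominate the indicator of [x != y], so its mean bounds the
    coupling error. *)
Lemma state_dist_ge1 x y : x != y -> 1 <= state_dist (x, y).
Proof.
move=> xy; have [i xyi] : exists i, x i != y i.
  apply/existsP; apply: contraNT xy; rewrite negb_exists => /forallP H.
  by apply/eqP/ffunP => i; have := H i; rewrite negbK => /eqP.
rewrite /state_dist (bigD1 i)//= -[leLHS]addr0 lerD//; last first.
  by apply: sumr_ge0 => j _; exact: normr_ge0.
have H p q : (p < q)%N -> 1 <= w q - w p.
  move=> pq; apply: le_trans (h_ge1 p) _; rewrite /h lerD2r.
  exact: weight_mono.
move: xyi; rewrite -val_eqE neq_ltn => /orP[] lt.
  by rewrite weight_distC weight_distE; [exact: H | exact: ltnW].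
by rewrite weight_distE; [exact: H | exact: ltnW].
Qed.

End State.
End Contraction.

(** * Mixing *)

Section Assembly.
Variables (R : realType) (alpha : R) (sigma K : nat).
Hypothesis alpha_gt0 : 0 < alpha.
Hypothesis sigma_lt : (sigma < K)%N.
Variables (v : nat -> R) (vm k1 c1 : R).
Hypothesis v_itv : forall p, (p <= K)%N -> 0 <= v p <= vm.
Hypothesis k1_gt0 : 0 < k1.
Hypothesis c1_gt0 : 0 < c1.
Hypothesis v_drift : forall a p, 0 <= a -> a <= 2 * (alpha * K%:R) ->
  (p <= K)%N -> link_gen alpha sigma K a v p <= k1 * (c1 - v p).

Let vm_ge0 : 0 <= vm.
Proof. by have /andP[] := v_itv (leq0n K); exact: le_trans. Qed.

Let rb_ge0 : 0 <= rate_bound alpha K.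
Proof.
have aK := alphaK_ge0 K alpha_gt0.
by rewrite /rate_bound mulr_ge0// addr_ge0 ?ler0n// mulr_ge0.
Qed.

Let T0 := vm / (k1 * c1).

Let T0_ge0 : 0 <= T0.
Proof. by rewrite /T0 divr_ge0// ltW// mulr_gt0. Qed.

(** A real-valued indicator, so that the semigroup acts on it and returns a probability. *)
Definition bad_state n (x : state K n) : R := (4 * c1 * n%:R < \sum_i v (x i))%R%:R.

Let bad01 n (x : state K n) : 0 <= bad_state x <= 1.
Proof. by rewrite /bad_state; case: (_ < _); rewrite /= lexx ler01. Qed.

Section Mixing.
Variable w : nat -> R.
Hypothesis slope_ge1 : forall i, 1 <= w i.+1 - w i.
Hypothesis slope_le : forall i, w i.+1 - w i <= w i.+2 - w i.+1.
Hypothesis good : forall n (x : state K n), (0 < n)%N ->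
  \sum_i v (x i) <= 4 * c1 * n%:R -> good_state alpha sigma w (1 / 2) x.

Let W := w K - w 0%N.

(** Contraction at rate 1/2 holds when both copies are good. Otherwise the drift is at most the
    total rate times the maximal distance, an error weighted by the probability that a copy is bad;
    the 8 is twice the 4 of [bad_prob]. *)
Lemma cpl_dist_decay : exists2 theta : R, 0 < theta & forall n, (0 < n)%N ->
  forall (z : state K n * state K n) t, T0 <= t ->
  semi (@cpl_gen R alpha sigma K n) t (@state_dist R K w n) z <=
    expR (- (1 / 2) * (t - T0)) * (n%:R * W) +
    (n%:R * rate_bound alpha K + 1 / 2) * (n%:R * W) *
      (8 * expR (- (theta * c1 * n%:R))) / (1 / 2).
Proof.
have [theta th0 Hbad] := bad_prob alpha_gt0 v_itv k1_gt0 c1_gt0 v_drift.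
exists theta => // n n0 [x y] t tT.
have n0R : 0 < n%:R :> R by rewrite ltr0n.
have G := cpl_gen_markov sigma K alpha_gt0 n.
have Fb (z : state K n * state K n) := state_dist_le (w := w) slope_ge1 z.
set M := n%:R * W; set c := n%:R * rate_bound alpha K.
have c0 : 0 <= c by rewrite mulr_ge0.
have M0 : 0 <= M by have /andP[] := Fb (x, y); exact: le_trans.
have lam0 : 0 < 1 / 2 :> R by lra.
have cM0 : 0 <= (c + 1 / 2) * M by rewrite mulr_ge0// addr_ge0// ltW.
have eta0 : 0 <= (c + 1 / 2) * M * (8 * expR (- (theta * c1 * n%:R))).
  by rewrite mulr_ge0// mulr_ge0// expR_ge0.
(* [c * M] covers the crude drift, and [1 / 2 * M] covers the term [- (1 / 2) * state_dist] kept on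
   the right. *)
pose D (z : state K n * state K n) := (c + 1 / 2) * M * (bad_state z.1 + bad_state z.2).
have FD z : cpl_gen alpha sigma (@state_dist R K w n) z <=
    - (1 / 2) * state_dist w z + D z.
  case: z => x' y'; have /andP[x0 x1] := bad01 x'; have /andP[y0 y1] := bad01 y'.
  have D0 : 0 <= D (x', y') by rewrite /D mulr_ge0// addr_ge0.
  have crude : 1 <= bad_state x' + bad_state y' ->
    cpl_gen alpha sigma (@state_dist R K w n) (x', y') <=
      - (1 / 2) * state_dist w (x', y') + D (x', y').
    move=> H1; have /andP[F0 F1] := Fb (x', y').
    have := markov_gen_le G (fun z => (andP (Fb z)).2) (x', y').
    have D1 : (c + 1 / 2) * M * 1 <= D (x', y') by rewrite /D ler_wpM2l.
    have F2 : 0 <= c * state_dist w (x', y') by rewrite mulr_ge0.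
    rewrite -/c -/M in F1 *; lra.
  have [badx|gx] := ltP (4 * c1 * n%:R) (\sum_i v (x' i)).
    by apply: crude; rewrite {1}/bad_state badx/= lerDl.
  have [bady|gy] := ltP (4 * c1 * n%:R) (\sum_i v (y' i)).
    by apply: crude; rewrite {2}/bad_state bady/= lerDr.
  have lam1 : 1 / 2 <= 1 :> R by lra.
  have := cpl_gen_dist alpha_gt0 sigma_lt lam1 slope_ge1 slope_le n0
    (good n0 gx) (good n0 gy).
  lra.
have Deta s : T0 <= s -> semi (@cpl_gen R alpha sigma K n) s D (x, y) <=
    (c + 1 / 2) * M * (8 * expR (- (theta * c1 * n%:R))).
  move=> sT; rewrite /D (fsemiM G) ler_wpM2l//.
  rewrite (fsemiD G (fun z => bad_state z.1) (fun z => bad_state z.2)).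
  rewrite semi_cpl_fst semi_cpl_snd.
  have := Hbad n x s n0R sT; have := Hbad n y s n0R sT; rewrite /bad_state; lra.
apply: le_trans (fsemi_gronwall G lam0 eta0 T0_ge0 FD Deta tT) _.
rewrite lerD2r ler_wpM2l ?expR_ge0//.
have Fn (z : state K n * state K n) : `|state_dist w z| <= M.
  by have /andP[F0 F1] := Fb z; rewrite ger0_norm.
exact: (semi_le_cst G _ Fn (fun z => (andP (Fb z)).2)).
Qed.

(** At time [60 * ln n] the contraction term is of order [n] times [n ^- 30], and the bad-state term
    is of order [n ^+ 2] times an exponentially small factor; both are bounded by a constant over
    [n]. *)
Lemma mixing eps : 0 < eps -> exists n0 : nat, forall n : nat,
  (n0 <= n)%N -> (1 <= n)%N -> forall Pi : state K n -> R,
  is_invariant (dar_rate alpha sigma K n) Pi ->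
  (tmix (dar_rate alpha sigma K n) Pi eps <= (60 * ln (n%:R : R))%:E)%E.
Proof.
move=> eps0; have [theta th0 H] := cpl_dist_decay.
have W0 : 0 <= W by rewrite subr_ge0; exact: weight_mono.
have tc0 : 0 < theta * c1 by rewrite mulr_gt0.
set rb := rate_bound alpha K in H *.
pose C := expR (T0 / 2) * W + 16 * (rb + 1) * W * (6 / (theta * c1) ^+ 3).
have [n1 Hn1] := large_nat C eps0.
have [n2 Hn2] := large_nat (expR T0) ltr01.
(* [n1] makes [C / n <= eps], and [n2] puts the burn-in [T0] below [ln n]. *)
exists (n1 + n2)%N => n nn n_1 Pi inv.
have n0R : 0 < n%:R :> R by rewrite ltr0n.
have n1R : 1 <= n%:R :> R by rewrite ler1n.
have {Hn1}HC : C / n%:R <= eps by apply: Hn1 => //; apply: leq_trans nn; exact: leq_addr.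
have {Hn2}HT : T0 <= ln n%:R.
  have : expR T0 / n%:R <= 1 by apply: Hn2 => //; apply: leq_trans nn; exact: leq_addl.
  rewrite ler_pdivrMr// mul1r => h.
  by rewrite -(expRK T0) ler_ln ?posrE ?expR_gt0.
have ln0 : 0 <= ln n%:R :> R by rewrite ln_ge0.
have t0 : 0 <= 60 * ln n%:R :> R by rewrite mulr_ge0.
have tT : T0 <= 60 * ln n%:R by lra.
have G := net_gen_markov sigma K alpha_gt0 n.
have GC := cpl_gen_markov sigma K alpha_gt0 n.
apply: (tv_dist_le (c := n%:R * rate_bound alpha K)) => //; first by rewrite qgen_dar.
  exact: ltW.
move=> A x y; rewrite qgen_dar.
rewrite -(semi_cpl_fst alpha sigma (fun z : state K n => (z \in A)%:R) _ x y).
rewrite -(semi_cpl_snd alpha sigma (fun z : state K n => (z \in A)%:R) _ x y).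
rewrite addrC -mulN1r -(fsemi_lin GC).
apply: (@le_trans _ _ (semi (@cpl_gen R alpha sigma K n) (60 * ln n%:R)
   (@state_dist R K w n) (x, y))).
  apply: (fsemi_mono GC) => // -[x' y'] /=.
  have [->|xy] := eqVneq x' y'.
    rewrite mulN1r addNr; have /andP[] := state_dist_le slope_ge1 (y', y').
    by [].
  apply: le_trans (state_dist_ge1 slope_ge1 xy).
  by case: (x' \in A); case: (y' \in A); rewrite /=; lra.
apply: le_trans (H n n_1 (x, y) _ tT) _.
apply: le_trans HC; rewrite /C [leRHS]mulrDl; apply: lerD.
  have -> : expR (- (1 / 2) * (60 * ln n%:R - T0)) =
      expR (T0 / 2) * expR (- (30 * ln n%:R)).
    by rewrite -expRD; congr expR; field.
  (* Of the decay [n ^- 30] only [n ^- 2] is used: it cancels the factor [n] of the maximal distance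
     and leaves [1 / n]. *)
  have : expR (- (30 * ln n%:R)) <= expR (- (2 * ln n%:R)) :> R.
    by rewrite ler_expR lerN2; lra.
  have -> : expR (- (2 * ln n%:R)) = (n%:R ^+ 2)^-1 :> R.
    by rewrite expRN expRM_natl lnK ?posrE.
  move=> le.
  have : expR (T0 / 2) * W * n%:R * expR (- (30 * ln n%:R)) <=
     expR (T0 / 2) * W * n%:R * (n%:R ^+ 2)^-1.
    by rewrite ler_wpM2l// !mulr_ge0// expR_ge0.
  have -> : expR (T0 / 2) * W * n%:R * (n%:R ^+ 2)^-1 = expR (T0 / 2) * W / n%:R.
    by field; rewrite gt_eqF.
  by apply: le_trans; rewrite le_eqVlt; apply/orP; left; apply/eqP; ring.
have tcn : 0 < theta * c1 * n%:R by rewrite mulr_gt0.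
have := expR_cube tcn; set E := expR _ => le.
have E0 : 0 <= E by exact: expR_ge0.
have -> : (n%:R * rb + 1 / 2) * (n%:R * W) * (8 * E) / (1 / 2) =
   16 * W * n%:R * E * (n%:R * rb + 1 / 2) by field.
apply: (@le_trans _ _ (16 * W * n%:R * E * (n%:R * (rb + 1)))).
  by rewrite ler_wpM2l ?mulr_ge0//; lra.
have -> : 16 * W * n%:R * E * (n%:R * (rb + 1)) =
  16 * W * n%:R * (n%:R * (rb + 1)) * E by ring.
have le2 : 16 * W * n%:R * (n%:R * (rb + 1)) * E <=
  16 * W * n%:R * (n%:R * (rb + 1)) * (6 / (theta * c1 * n%:R) ^+ 3).
  by rewrite ler_wpM2l// !mulr_ge0// addr_ge0.
apply: le_trans le2 _; rewrite le_eqVlt; apply/orP; left; apply/eqP.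
by field; rewrite !gt_eqF.
Qed.

End Mixing.

(** Outside bad states [v K = 1] gives a full proportion of at most [4 * c1], which caps the extra
    rate and makes the sharper drift available. A second Gronwall bound, averaged over the invariant
    law, concludes. *)
Lemma full_prop_small delta : 0 < delta -> v K = 1 ->
  (forall a p, 0 <= a -> a <= 2 * (alpha * K%:R) * (4 * c1) -> (p <= K)%N ->
    link_gen alpha sigma K a v p <= - v p + delta / 2) ->
  exists n0 : nat, forall n : nat, (n0 <= n)%N -> (1 <= n)%N ->
  forall Pi : state K n -> R, is_invariant (dar_rate alpha sigma K n) Pi ->
  \sum_(x : state K n) Pi x * full_prop R x <= delta.
Proof.
move=> d0 vK drift.
have [theta th0 Hbad] := bad_prob alpha_gt0 v_itv k1_gt0 c1_gt0 v_drift.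
have tc0 : 0 < theta * c1 by rewrite mulr_gt0.
set rb := rate_bound alpha K.
pose C := vm + 4 * vm * (rb + 1) * (6 / (theta * c1) ^+ 3).
have d20 : 0 < delta / 2 by rewrite divr_gt0.
have [n1 Hn1] := large_nat C d20.
exists n1 => n nn n_1 Pi inv.
have n0R : 0 < n%:R :> R by rewrite ltr0n.
have n1R : 1 <= n%:R :> R by rewrite ler1n.
have {Hn1}HC : C / n%:R <= delta / 2 by exact: Hn1.
have G := net_gen_markov sigma K alpha_gt0 n.
set c := n%:R * rate_bound alpha K in G *.
have c0 : 0 <= c by rewrite mulr_ge0.
pose F (x : state K n) := \sum_i v (x i).
pose M := n%:R * vm.
have M0 : 0 <= M by rewrite mulr_ge0.
have F0 x : 0 <= F x.
  by apply: sumr_ge0 => i _; have /andP[] := v_itv (ord_leK x i).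
have FM x : F x <= M.
  rewrite /M mulr_natl -[X in _ *+ X]card_ord -sumr_const; apply: ler_sum => i _.
  by have /andP[] := v_itv (ord_leK x i).
have fF x : n%:R * full_prop R x <= F x.
  rewrite full_propE//; apply: ler_sum => i _.
  case: eqP => [->|_]; first by rewrite vK.
  by have /andP[] := v_itv (ord_leK x i).
pose D (x : state K n) := (c + 1) * M * bad_state x + n%:R * (delta / 2).
have FD x : net_gen alpha sigma F x <= - 1 * F x + D x.
  have /andP[x0 x1] := bad01 x.
  have cM : 0 <= (c + 1) * M by rewrite mulr_ge0// addr_ge0.
  have nd : 0 <= n%:R * (delta / 2) by rewrite mulr_ge0// ltW.
  have [badx|gx] := ltP (4 * c1 * n%:R) (F x).
    rewrite /D /bad_state -/(F x) badx /= mulr1.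
    have := markov_gen_le G FM x.
    have : 0 <= c * F x by rewrite mulr_ge0.
    have := FM x; lra.
  have D0 : n%:R * (delta / 2) <= D x by rewrite /D lerDr mulr_ge0.
  have /andP[a0 _] := extra_itv sigma alpha_gt0 x.
  have a1 : extra alpha sigma x <= 2 * (alpha * K%:R) * (4 * c1).
    have aK := alphaK_ge0 K alpha_gt0.
    have /andP[f0 f1] : 0 <= full_prop R x <= 1 := prop_itv _ _.
    have /andP[g0 g1] : 0 <= reserved_prop R sigma x <= 1 := prop_itv _ _.
    have f4 : full_prop R x <= 4 * c1.
      by rewrite -(ler_pM2l n0R) [leRHS]mulrC; exact: le_trans (fF x) gx.
    apply: ler_wpM2l; [by rewrite mulr_ge0 | apply: (le_trans _ f4)].
    by rewrite ler_piMr//; lra.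
  rewrite net_gen_sum mulN1r; apply: (@le_trans _ _ (\sum_j (- v (x j) + delta / 2))).
    by apply: ler_sum => j _; apply: drift => //; exact: ord_leK.
  rewrite big_split /= sumrN sumr_const card_ord -[_ *+ n]mulr_natl; exact: lerD.
pose eta := (c + 1) * M * (4 * expR (- (theta * c1 * n%:R))) + n%:R * (delta / 2).
have eta0 : 0 <= eta.
  by rewrite addr_ge0// mulr_ge0 ?(ltW d20)// mulr_ge0 ?addr_ge0 ?expR_ge0.
have Deta x s : T0 <= s -> semi (@net_gen R alpha sigma K n) s D x <= eta.
  move=> sT; rewrite /D (fsemi_lin G) (semi_cst G) lerD2r ler_wpM2l//.
    by rewrite mulr_ge0// addr_ge0.
  exact: Hbad.
have Fn x : `|F x| <= M by rewrite ger0_norm.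
(* An additional time [n] makes the exponential factor at most [1 / n], so the initial value, at
   most [n * vm], contributes at most [vm]. *)
pose t := T0 + n%:R.
have tT : T0 <= t by rewrite lerDl ltW.
have t0 : 0 <= t by exact: le_trans tT.
have Ft x : semi (@net_gen R alpha sigma K n) t F x <= n%:R * delta.
  apply: le_trans (fsemi_gronwall G ltr01 eta0 T0_ge0 FD (Deta x) tT) _.
  have e1 : expR (- 1 * (t - T0)) <= n%:R^-1.
    rewrite /t addrAC subrr add0r mulN1r expRN lef_pV2 ?posrE ?expR_gt0//.
    by apply: le_trans (expR_ge1Dx _); lra.
  have FT : semi (@net_gen R alpha sigma K n) T0 F x <= M.
    exact: (semi_le_cst G _ Fn FM).
  have FT0 : 0 <= semi (@net_gen R alpha sigma K n) T0 F x.
    exact: (semi_ge0 G _ Fn F0).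
  have P1 : expR (- 1 * (t - T0)) * semi (@net_gen R alpha sigma K n) T0 F x <= vm.
    apply: (@le_trans _ _ (n%:R^-1 * M)); last by rewrite /M mulKf// gt_eqF.
    by apply: ler_pM => //; exact: expR_ge0.
  rewrite divr1 /eta.
  have tcn : 0 < theta * c1 * n%:R by rewrite mulr_gt0.
  have le := expR_cube tcn.
  have P2 : (c + 1) * M * (4 * expR (- (theta * c1 * n%:R))) <=
      4 * vm * (rb + 1) * (6 / (theta * c1) ^+ 3).
    apply: (@le_trans _ _ (n%:R * (rb + 1) * M * (4 * (6 / (theta * c1 * n%:R) ^+ 3)))).
      apply: ler_pM; rewrite ?mulr_ge0 ?expR_ge0 ?addr_ge0//.
        by rewrite ler_wpM2r// mulrDr mulr1 lerD2l.
      by rewrite ler_pM2l.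
    apply: (@le_trans _ _ (4 * vm * (rb + 1) * (6 / (theta * c1) ^+ 3) / n%:R)).
      rewrite le_eqVlt; apply/orP; left; apply/eqP; rewrite /M.
      by field; rewrite !gt_eqF.
    rewrite ler_pdivrMr// ler_peMr// !mulr_ge0 ?addr_ge0// invr_ge0 exprn_ge0//.
    exact: ltW.
  have : C <= n%:R * (delta / 2) by rewrite -ler_pdivrMl// mulrC.
  have : n%:R * delta = n%:R * (delta / 2) + n%:R * (delta / 2) by field.
  rewrite /C; lra.
have [[Pi0 Pi1] _] := inv.
have GQ : markov_gen (qgen (dar_rate alpha sigma K n)) c by rewrite qgen_dar.
have := invariant_semi F GQ inv t0; rewrite qgen_dar => E.
rewrite -(ler_pM2l n0R); apply: (@le_trans _ _ (\sum_x Pi x * F x)).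
  rewrite mulr_sumr; apply: ler_sum => x _; rewrite mulrCA; exact: ler_wpM2l.
rewrite -E; apply: (@le_trans _ _ (\sum_x Pi x * (n%:R * delta))).
  by apply: ler_sum => x _; exact: ler_wpM2l.
by rewrite -mulr_suml Pi1 mul1r.
Qed.

End Assembly.

(** * Choice of the parameters *)

Section Regimes.
Variable R : realType.

(** For a geometric function the upward increment is [(r - 1)] times its value and the downward one
    is [- r^-1] times that, so the drift factors. *)
Lemma geo_drift (alpha : R) (sigma K : nat) (a Z r : R) p : r != 0 ->
  (p <= K)%N ->
  link_gen alpha sigma K a (fun p => Z * r ^+ p) p =
    (r - 1) * (Z * r ^+ p) * (link_rate alpha sigma K a true p - r^-1 * p%:R).
Proof.
move=> r0 pK; rewrite /link_gen sum_bool.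
have -> : link_rate alpha sigma K a true p *
     (Z * r ^+ link_move K true p - Z * r ^+ p) =
    link_rate alpha sigma K a true p * ((r - 1) * (Z * r ^+ p)).
  have [pK'|Kp] := ltnP p K.
    by rewrite /link_move (minn_idPr pK') exprS; ring.
  rewrite /link_rate ltnNge (leq_trans _ Kp) ?leq_subr//= ltnNge Kp !mul0r.
  by [].
rewrite [link_rate _ _ _ _ false _]/= /link_move.
case: p {pK} => [|p] /=; first by rewrite !mul0r; ring.
by rewrite exprS; field.
Qed.

(** * The case [alpha > 1]: most links are reserved and the weight is linear *)

Section Supercritical.
Variable alpha : R.
Hypothesis alpha_gt1 : 1 < alpha.

Lemma mixing_supercritical : exists sigma_star : nat,
  forall sigma : nat, (sigma_star <= sigma)%N -> forall eps : R, 0 < eps ->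
  forall K : nat, (sigma < K)%N ->
  exists n0 : nat, forall n : nat, (n0 <= n)%N -> (1 <= n)%N ->
  forall Pi : state K n -> R, is_invariant (dar_rate alpha sigma K n) Pi ->
  (tmix (dar_rate alpha sigma K n) Pi eps <= (60 * ln (n%:R : R))%:E)%E.
Proof.
have alpha_gt0 : 0 < alpha := lt_trans ltr01 alpha_gt1.
(* Any [s] strictly between 1 and [alpha] gives [v], with ratio [1 / s], a downward drift below [K],
   since arrivals exceed [s * K]. *)
pose s := (1 + alpha) / 2.
have [s1 sa] : 1 < s /\ s < alpha by move: alpha_gt1; rewrite /s; split; lra.
have s0 : 0 < s := lt_trans ltr01 s1.
pose q := s^-1.
have qV : q^-1 = s by rewrite invrK.
have q0 : 0 < q by rewrite invr_gt0.
have q1 : q < 1 by rewrite invf_lt1.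
pose kappa := (1 - q) * (alpha - s).
have kappa0 : 0 < kappa by rewrite mulr_gt0// subr_gt0.
have sk : 0 < s - 1 + kappa by rewrite addr_gt0// subr_gt0.
have [N HN] := pow_small (ltW q0) q1 (divr_gt0 (mulr_gt0 kappa0 (ltac:(lra) : 0 < 1 / 8 :> R)) sk).
exists N => sigma Ns eps eps0 K sK.
have {HN Ns}qs : q ^+ sigma * (s - 1 + kappa) <= kappa * (1 / 8).
  by have := HN _ Ns; rewrite ler_pdivlMr.
have K0 : 0 < K%:R :> R by rewrite ltr0n (leq_ltn_trans _ sK).
(* Normalized so that [v] is at least 1 on unreserved links; the sum of [v] then dominates
   [n * (1 - g)]. *)
pose Z := s ^+ (K - sigma).
have Z0 : 0 < Z by exact: exprn_gt0.
pose v p := Z * q ^+ p.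
have v0 p : 0 <= v p by rewrite mulr_ge0 ?exprn_ge0// ltW.
have vK : v K = q ^+ sigma.
  rewrite /v /Z -{2}(subnK (ltnW sK)) exprD mulrA -exprMn.
  by rewrite /q divff ?gt_eqF// expr1n mul1r.
have v1 p : (p < K - sigma)%N -> 1 <= v p.
  move=> pK; rewrite /v /Z -(subnK (ltnW pK)) exprD -mulrA -exprMn.
  by rewrite /q divff ?gt_eqF// expr1n mulr1 exprn_ege1// ltW.
have v_itv p : (p <= K)%N -> 0 <= v p <= Z.
  by move=> _; rewrite v0 /= ler_piMr ?(ltW Z0)// exprn_ile1// ltW.
have k0 : 0 < kappa * K%:R by rewrite mulr_gt0.
have c0 : 0 < 1 / 8 :> R by lra.
have drift a p : 0 <= a -> a <= 2 * (alpha * K%:R) -> (p <= K)%N ->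
    link_gen alpha sigma K a v p <= kappa * K%:R * (1 / 8 - v p).
  move=> a0 a2 pK; rewrite geo_drift ?gt_eqF// -/(v p) qV.
  have [pK'|Kp] := ltnP p K.
    have rate : alpha * K%:R <= link_rate alpha sigma K a true p.
      by rewrite /link_rate pK'; case: ifP => // _; rewrite lerDl.
    have sp : s * p%:R <= s * K%:R by rewrite ler_pM2l// ler_nat.
    have H : (1 - q) * v p * ((alpha - s) * K%:R) <=
       (1 - q) * v p * (link_rate alpha sigma K a true p - s * p%:R).
      apply: ler_wpM2l; first by rewrite mulr_ge0// subr_ge0 ltW.
      lra.
    have : 0 <= kappa * K%:R * (1 / 8) by rewrite ltW// mulr_gt0.
    have : (1 - q) * v p * ((alpha - s) * K%:R) = kappa * K%:R * v p.
      by rewrite /kappa; ring.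
    lra.
  (* A full link has no arrivals and its [v] has upward drift; a large [sigma] makes
     [v K = q ^+ sigma] small enough to compensate. *)
  have pE : p = K by apply/eqP; rewrite eqn_leq pK.
  rewrite {}pE in Kp *.
  have -> : link_rate alpha sigma K a true K = 0.
    by rewrite /link_rate ltnNge leq_subr /= ltnn.
  rewrite vK sub0r.
  have -> : (q - 1) * q ^+ sigma * - (s * K%:R) = q ^+ sigma * (s - 1) * K%:R.
    have -> : (q - 1) * q ^+ sigma * - (s * K%:R) = q ^+ sigma * (s - q * s) * K%:R.
      by ring.
    by rewrite mulVf ?gt_eqF.
  have : q ^+ sigma * (s - 1 + kappa) * K%:R <= kappa * (1 / 8) * K%:R.
    by rewrite ler_pM2r.
  lra.
have e (i : nat) : (i.+1%:R - i%:R : R) = 1 by rewrite -natr1; ring.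
apply: (mixing alpha_gt0 sK v_itv k0 c0 drift (w := fun p => p%:R)) => //.
- by move=> i; rewrite e.
- by move=> i; rewrite !e.
move=> n x n0 Sv; split.
  by move=> i _; rewrite !e !subrr !mulr0 add0r; lra.
have n0R : 0 < n%:R :> R by rewrite ltr0n.
(* Here [4 * c1 = 1 / 2], and with unit slopes [2 * (1 / 2) ^+ 2 <= 1] is the required slope
   condition. *)
have h1 : 1 - reserved_prop R sigma x <= 1 / 2.
  rewrite -(ler_pM2l n0R) reserved_propE//.
  have : \sum_i (x i < K - sigma)%N%:R <= \sum_i v (x i).
    by apply: ler_sum => i _; case: ltnP => // /v1.
  lra.
have /andP[_ h0] : 0 <= reserved_prop R sigma x <= 1 := prop_itv _ _.
rewrite !e mulr1.
have : (1 - reserved_prop R sigma x) ^+ 2 <= (1 / 2) ^+ 2.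
  by rewrite lerXn2r// nnegrE; lra.
rewrite !expr2; lra.
Qed.

End Supercritical.

(** * The case [alpha < 1]: few links are full and the weight has a geometric part *)

Section Subcritical.
Variable alpha : R.
Hypothesis alpha_gt0 : 0 < alpha.
Hypothesis alpha_lt1 : alpha < 1.

Lemma subcritical : exists sigma_star : nat,
  forall sigma : nat, (sigma_star <= sigma)%N ->
  (exists K0 : nat, forall K : nat, (K0 <= K)%N -> (sigma < K)%N ->
    forall eps : R, 0 < eps ->
    exists n0 : nat, forall n : nat, (n0 <= n)%N -> (1 <= n)%N ->
    forall Pi : state K n -> R, is_invariant (dar_rate alpha sigma K n) Pi ->
    (tmix (dar_rate alpha sigma K n) Pi eps <= (60 * ln (n%:R : R))%:E)%E) /\
  forall delta : R, 0 < delta ->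
    exists K1 : nat, forall K : nat, (K1 <= K)%N -> (sigma < K)%N ->
    exists n1 : nat, forall n : nat, (n1 <= n)%N -> (1 <= n)%N ->
    forall Pi : state K n -> R, is_invariant (dar_rate alpha sigma K n) Pi ->
    \sum_(x : state K n) Pi x * full_prop R x <= delta.
Proof.
pose rho := (1 + alpha) / 2.
have rho0 : 0 < rho by move: alpha_gt0; rewrite /rho; lra.
have rho1 : rho < 1 by move: alpha_lt1; rewrite /rho; lra.
pose r := rho^-1.
have r0 : 0 < r by rewrite invr_gt0.
have r1 : 1 < r by rewrite invf_gt1.
have rV : r^-1 = rho by rewrite invrK.
have rr : r * rho = 1 by rewrite mulVf// gt_eqF.
pose d := alpha * r.
have d0 : 0 < d by rewrite mulr_gt0.
have d1 : d < 1 by move: alpha_lt1; rewrite /d ltr_pdivrMr// mul1r /rho; lra.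
have drho : d * rho = alpha by rewrite /d -mulrA rr mulr1.
(* [f0 = 4 * c1] is the tolerated full proportion: below it, [r] times the arrival rate is at most
   [beta * K] with [beta < 1]. *)
pose f0 := (1 - d) / 4.
have f00 : 0 < f0 by rewrite divr_gt0// subr_gt0.
pose beta := (1 + d) / 2.
have beta1 : beta < 1 by rewrite /beta; lra.
pose kappa := (1 - rho) * (1 - d) / 2.
have kappa0 : 0 < kappa by rewrite divr_gt0// mulr_gt0// subr_gt0.
pose c1 := f0 / 4.
have c10 : 0 < c1 by rewrite divr_gt0.
pose den := (r - 1) * (3 * alpha) + kappa.
have den0 : 0 < den by rewrite addr_gt0// mulr_gt0 ?subr_gt0// mulr_gt0.
have c38 : 0 < 3 / 8 :> R by lra.
(* [N1] serves the slope condition: [1 + 4 * rho ^+ sigma <= 5 / 2], half of the slope 5 at [K.-1].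
   [N2] serves the drift of [v] on unreserved links, where [v <= rho ^+ sigma]. *)
have [N1 HN1] := pow_small (ltW rho0) rho1 c38.
have [N2 HN2] := pow_small (ltW rho0) rho1 (divr_gt0 (mulr_gt0 kappa0 c10) den0).
exists (N1 + N2)%N => sigma Ns.
have {HN1}rs1 : rho ^+ sigma <= 3 / 8.
  by apply: HN1; apply: leq_trans Ns; exact: leq_addr.
have {HN2}rs2 : rho ^+ sigma * den <= kappa * c1.
  by rewrite -ler_pdivlMr//; apply: HN2; apply: leq_trans Ns; exact: leq_addl.
(* For [K >= Ks] one has [2 * sigma <= (1 - d) * K], so on reserved links the departures exceed
   [d * K] by at least [(1 - d) / 2 * K]. *)
pose Ks := Num.bound `|2 * sigma%:R / (1 - d)|.
pose v K p := rho ^+ K * r ^+ p.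
have vE K p : (p <= K)%N -> v K p = rho ^+ (K - p).
  move=> pK; rewrite /v -{1}(subnK pK) exprD -mulrA -exprMn [rho * r]mulrC rr.
  by rewrite expr1n mulr1.
have v0 K p : 0 < v K p by rewrite mulr_gt0// exprn_gt0.
have v_itv K p : (p <= K)%N -> 0 <= v K p <= 1.
  by move=> pK; rewrite (ltW (v0 K p)) vE//= exprn_ile1// ltW.
have k0 (K : nat) : (sigma < K)%N -> 0 < kappa * K%:R.
  by move=> sK; rewrite mulr_gt0// ltr0n (leq_ltn_trans _ sK).
have linkE K a p : (p <= K)%N -> link_gen alpha sigma K a (v K) p =
    (1 - rho) * v K p * (r * link_rate alpha sigma K a true p - p%:R).
  move=> pK; rewrite geo_drift ?gt_eqF// -/(v K p) rV.
  have -> : r - 1 = r * (1 - rho) by rewrite mulrBr mulr1 rr.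
  transitivity ((1 - rho) * v K p *
    (r * link_rate alpha sigma K a true p - r * rho * p%:R)); first by ring.
  by rewrite rr mul1r.
have rho_1 : 0 < 1 - rho by rewrite subr_gt0.
have drift K : (Ks <= K)%N -> (sigma < K)%N ->
    forall a p, 0 <= a -> a <= 2 * (alpha * K%:R) -> (p <= K)%N ->
    link_gen alpha sigma K a (v K) p <= kappa * K%:R * (c1 - v K p).
  move=> KK sK a p a0 a2 pK; rewrite linkE//.
  have K0 : 0 < K%:R :> R by rewrite ltr0n (leq_ltn_trans _ sK).
  have Ksig : 2 * sigma%:R <= (1 - d) * K%:R.
    rewrite [leRHS]mulrC -ler_pdivrMr ?subr_gt0//; apply: le_trans (ler_norm _) _; apply/ltW.
    by apply: lt_le_trans (archi_boundP (normr_ge0 _)) _; rewrite ler_nat.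
  have kc : 0 <= kappa * K%:R * c1 by rewrite ltW// mulr_gt0// k0.
  have [pm|mp] := ltnP p (K - sigma).
    have vs : v K p <= rho ^+ sigma.
      rewrite vE//; apply: ler_wiXn2l; [exact: ltW | exact: ltW |].
      by clear - pm pK; lia.
    have rate : link_rate alpha sigma K a true p <= 3 * (alpha * K%:R).
      by rewrite /link_rate pm; lra.
    have H1 : (1 - rho) * v K p * (r * link_rate alpha sigma K a true p - p%:R) <=
        (1 - rho) * v K p * (r * (3 * (alpha * K%:R))).
      apply: ler_wpM2l; first by rewrite mulr_ge0// ltW.
      have : r * link_rate alpha sigma K a true p <= r * (3 * (alpha * K%:R)).
        by rewrite ler_pM2l.
      have : 0 <= p%:R :> R by [].
      lra.
    have E : (1 - rho) * v K p * (r * (3 * (alpha * K%:R))) =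
        v K p * ((r - 1) * (3 * alpha)) * K%:R.
      have -> : r - 1 = r * (1 - rho) by rewrite mulrBr mulr1 rr.
      ring.
    have H2 : v K p * den * K%:R <= kappa * c1 * K%:R.
      rewrite ler_pM2r//; apply: le_trans rs2.
      by rewrite ler_pM2r.
    move: H2; rewrite /den; lra.
  have rate : link_rate alpha sigma K a true p <= alpha * K%:R.
    rewrite /link_rate ltnNge mp /=; case: ifP => // _.
    by rewrite mulr_ge0// ltW.
  have pR : K%:R - sigma%:R <= p%:R :> R.
    by rewrite lerBlDr -natrD ler_nat addnC -leq_subLR.
  have H1 : (1 - rho) * v K p * (r * link_rate alpha sigma K a true p - p%:R) <=
      (1 - rho) * v K p * (- ((1 - d) / 2 * K%:R)).
    apply: ler_wpM2l; first by rewrite mulr_ge0// ltW.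
    have : r * link_rate alpha sigma K a true p <= d * K%:R.
      have -> : d * K%:R = r * (alpha * K%:R) by rewrite /d; ring.
      by rewrite ler_pM2l.
    lra.
  have : (1 - rho) * v K p * (- ((1 - d) / 2 * K%:R)) = - (kappa * K%:R * v K p).
    by rewrite /kappa; field.
  lra.
have small_rate K a p : 0 <= a -> a <= 2 * (alpha * K%:R) * (4 * c1) ->
    r * link_rate alpha sigma K a true p <= beta * K%:R.
  move=> a0 a1.
  have aK : 0 <= alpha * K%:R by rewrite mulr_ge0// ltW.
  have H : link_rate alpha sigma K a true p <= alpha * K%:R + a.
    rewrite /link_rate; case: ifP => // _; case: ifP => _; first by rewrite lerDl.
    by rewrite addr_ge0.
  have H1 : alpha * K%:R + a <= alpha * K%:R * (1 + 2 * f0).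
    by move: a1; rewrite /c1; lra.
  have H2 : r * link_rate alpha sigma K a true p <= r * (alpha * K%:R * (1 + 2 * f0)).
    by rewrite ler_pM2l//; exact: le_trans H1.
  apply: le_trans H2 _.
  have -> : r * (alpha * K%:R * (1 + 2 * f0)) = d * (1 + 2 * f0) * K%:R.
    by rewrite /d; ring.
  rewrite ler_wpM2r//.
  have : d * (1 - d) <= 1 * (1 - d) by rewrite ler_pM2r ?subr_gt0// ltW.
  by rewrite /f0 /beta; lra.
(* Multiplied by the [4 * r] of the slope, this is 1/2, the constant part of [(1 - 1 / 2) * h i]. *)
have tau0 : 0 < 1 / (8 * r) by rewrite divr_gt0// mulr_gt0.
split.
  have [Kp HKp] := geo_peak (ltW rho0) rho1 beta1 rho_1 tau0.
  exists (Ks + Kp)%N => K KK sK eps eps0.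
  have KKs : (Ks <= K)%N by apply: leq_trans KK; exact: leq_addr.
  have KKp : (Kp <= K)%N by apply: leq_trans KK; exact: leq_addl.
  (* The coefficient gives the slope [1 + 4 * v K p.+1], which is 5 at [K.-1] and
     [1 + 4 * rho ^+ sigma] at [(K - sigma).-1]. *)
  pose w p := p%:R + 4 * r / (r - 1) * v K p.
  have slope p : w p.+1 - w p = 1 + 4 * r * v K p.
    rewrite /w -natr1 /v exprS; field.
    by rewrite subr_eq0 gt_eqF.
  have vS p : v K p.+1 = r * v K p by rewrite /v exprS; ring.
  have r_1 : r - 1 = r * (1 - rho) by rewrite mulrBr mulr1 rr.
  have slopeS p : 1 + 4 * r * v K p.+1 - (1 + 4 * r * v K p) =
      4 * r * (r * (1 - rho)) * v K p.
    by rewrite vS -r_1; ring.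
  have slopeP p : p%:R * (1 + 4 * r * v K p - (1 + 4 * r * v K p.-1)) =
      4 * r * (1 - rho) * v K p * p%:R.
    case: p => [|p]; first by rewrite mul0r mulr0.
    by rewrite slopeS vS; ring.
  apply: (mixing alpha_gt0 sK (v_itv K) (k0 K sK) c10 (drift K KKs sK) (w := w)) => //.
  - by move=> i; rewrite slope lerDl ltW// (mulr_gt0 _ (v0 K i))// mulr_gt0.
  - move=> i; rewrite !slope lerD2l ler_pM2l ?mulr_gt0//.
    by rewrite /v exprS ler_pM2l ?exprn_gt0// ler_peMl ?exprn_ge0// ltW.
  move=> n x n0 Sv.
  have n0R : 0 < n%:R :> R by rewrite ltr0n.
  have fx : full_prop R x <= 4 * c1.
    rewrite -(ler_pM2l n0R) full_propE// [leRHS]mulrC.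
    apply: le_trans Sv; apply: ler_sum => i _.
    case: eqP => [->|_]; last by rewrite ltW.
    by rewrite vE// subnn.
  have /andP[a0 _] := extra_itv sigma alpha_gt0 x.
  have /andP[f_0 _] : 0 <= full_prop R x <= 1 := prop_itv _ _.
  have /andP[g0 g1] : 0 <= reserved_prop R sigma x <= 1 := prop_itv _ _.
  have aK : 0 <= alpha * K%:R by rewrite mulr_ge0// ltW.
  have a1 : extra alpha sigma x <= 2 * (alpha * K%:R) * (4 * c1).
    apply: ler_wpM2l; first by rewrite mulr_ge0.
    by apply: (le_trans _ fx); rewrite ler_piMr//; lra.
  split.
    move=> i iK; rewrite !slope slopeS slopeP.
    have -> : alpha * K%:R + (if (i.+1 < K - sigma)%N then extra alpha sigma x else 0) =
        link_rate alpha sigma K (extra alpha sigma x) true i.+1.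
      by rewrite /link_rate iK; case: ifP; rewrite ?addr0.
    have := small_rate K (extra alpha sigma x) i.+1 a0 a1.
    set A := link_rate _ _ _ _ _ _ => HA.
    have iK' : (i <= K)%N by apply: ltnW; exact: ltnW.
    have := HKp K i KKp iK'; rewrite -vE// ler_pdivlMr ?mulr_gt0// => HP.
    have H1 : 4 * r * (1 - rho) * v K i * (r * A) <=
        4 * r * (1 - rho) * v K i * (beta * K%:R).
      apply: ler_wpM2l HA; apply: mulr_ge0; last exact: ltW.
      by apply: mulr_ge0; [rewrite mulr_ge0 ?(ltW r0) | exact: ltW].
    have rv : 0 < r * v K i by rewrite mulr_gt0.
    lra.
  have KE : (K.-1.+1 = K)%N by rewrite prednK// (leq_ltn_trans _ sK).
  have mE : ((K - sigma).-1.+1 = K - sigma)%N by rewrite prednK// subn_gt0.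
  rewrite !slope -!mulrA -!vS KE mE !vE ?leq_subr// subnn expr0.
  rewrite subKn; last exact: ltnW.
  have H1 : (1 - reserved_prop R sigma x) ^+ 2 <= 1.
    by rewrite exprn_ile1//; lra.
  have H2 : (1 - reserved_prop R sigma x) ^+ 2 * (1 + 4 * rho ^+ sigma) <= 1 * (5 / 2).
    apply: ler_pM => //; first exact: sqr_ge0.
      by rewrite addr_ge0// mulr_ge0// exprn_ge0// ltW.
    by lra.
  lra.
move=> delta delta0.
have d20 : 0 < delta / 2 by rewrite divr_gt0.
(* The summand 1 in the bracket of [geo_peak] provides the term [- v K p] of the sharper drift. *)
have [Kp HKp] := geo_peak (ltW rho0) rho1 beta1 rho_1 d20.
exists (Ks + Kp)%N => K KK sK.
have KKs : (Ks <= K)%N by apply: leq_trans KK; exact: leq_addr.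
have KKp : (Kp <= K)%N by apply: leq_trans KK; exact: leq_addl.
apply: (full_prop_small alpha_gt0 (v_itv K) (k0 K sK) c10 (drift K KKs sK) delta0).
  by rewrite vE// subnn.
move=> a p a0 a1 pK; rewrite linkE//.
have := HKp K p KKp pK; rewrite -vE//.
have : (1 - rho) * v K p * (r * link_rate alpha sigma K a true p - p%:R) <=
   (1 - rho) * v K p * (beta * K%:R - p%:R).
  apply: ler_wpM2l; first by rewrite mulr_ge0// ltW.
  by rewrite lerD2r; exact: small_rate.
lra.
Qed.

End Subcritical.
End Regimes.

Theorem theorem3 (R : realType) (alpha : R) (alpha_gt0 : 0 < alpha)
    (alpha_neq1 : alpha != 1) :
  exists sigma_star : nat, forall sigma : nat, (sigma_star <= sigma)%N ->
    (forall eps : R, 0 < eps -> eps < 1 ->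
      exists K0 : nat, forall K : nat, (K0 <= K)%N -> (sigma < K)%N ->
      exists n0 : nat, forall n : nat, (n0 <= n)%N -> (1 <= n)%N ->
      forall Pi : state K n -> R,
        is_invariant (dar_rate alpha sigma K n) Pi ->
        (tmix (dar_rate alpha sigma K n) Pi eps
           <= (60 * ln (n%:R : R))%:E)%E)
    /\
    (alpha < 1 ->
      forall delta : R, 0 < delta ->
      exists K1 : nat, forall K : nat, (K1 <= K)%N -> (sigma < K)%N ->
      exists n1 : nat, forall n : nat, (n1 <= n)%N -> (1 <= n)%N ->
      forall Pi : state K n -> R,
        is_invariant (dar_rate alpha sigma K n) Pi ->
        \sum_(x : state K n) Pi x * full_prop R x <= delta).
Proof.
case: (ltgtP alpha 1) alpha_neq1 => // [alpha_lt1|alpha_gt1] _.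
  have [N HN] := subcritical alpha_gt0 alpha_lt1.
  exists N => sigma Ns; have [[K0 mix] small] := HN sigma Ns; split=> // eps e0 _.
  by exists K0 => K KK sK; exact: mix.
have [N HN] := mixing_supercritical alpha_gt1.
exists N => sigma Ns; split=> // eps e0 _.
by exists 0%N => K _ sK; exact: HN.
Qed.
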